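(* Let $f\in\mathcal{D}_2(\mathbf{L}_{q,\mathfrak{I}_N})$ be a solution of $\mathbf{L}_{q,\mathfrak{I}_N}f=0$ with $f(x)\neq0$ for all $x\in[0,b]$ and $f(0)=1$, and set $h=f'(0)$. The canonical transmutation operator $\mathbf{T}^f_{\mathfrak{I}_N}$ satisfies $$\mathbf{T}^f_{\mathfrak{I}_N}\left[x^k\right]=\varphi_f^{(k)}(x)\qquad\forall k\in\mathbb{N}_0.$$ The canonical cosine and sine transmutation operators satisfy $$\mathbf{T}^C_{\mathfrak{I}_N,f}\left[x^{2k}\right]=\varphi_f^{(2k)}(x),\qquad\mathbf{T}^S_{\mathfrak{I}_N}\left[x^{2k+1}\right]=\varphi_f^{(2k+1)}(x)\qquad\forall k\in\mathbb{N}_0.$$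
   Context: Let $b>0$, let $q\in L_2(0,b)$ be complex valued, $N\in\mathbb{N}$, $0<x_1<\dots<x_N<b$, $\alpha_1,\dots,\alpha_N\in\mathbb{C}\setminus\{0\}$, $x_0=0$, $x_{N+1}=b$, $\mathfrak{I}_N=\{(x_j,\alpha_j)\}_{j=1}^N$. $\mathcal{D}_2(\mathbf{L}_{q,\mathfrak{I}_N})$ is the set of $u\in AC[0,b]$ such that $u|_{(x_k,x_{k+1})}\in H^2(x_k,x_{k+1})$ for $k=0,\dots,N$ and $u'(x_k+)-u'(x_k-)=\alpha_ku(x_k)$ for $k=1,\dots,N$. A solution of $\mathbf{L}_{q,\mathfrak{I}_N}u=\lambda u$ (formally $-u''+(q+\sum_{k=1}^N\alpha_k\delta(x-x_k))u=\lambda u$) is a function $u\in\mathcal{D}_2(\mathbf{L}_{q,\mathfrak{I}_N})$ satisfying $-u''+qu=\lambda u$ a.e. on each $(x_k,x_{k+1})$. For $h\in\mathbb{C}$, $K^h_{\mathfrak{I}_N}(x,t)$, $0<x\le b$, $|t|\le x$, is the transmutation kernel: the ($\rho$-independent) kernel with $K^h_{\mathfrak{I}_N}\in L_\infty$ and $K^h_{\mathfrak{I}_N}(x,\cdot)\in L_2(-x,x)$ such that $e^h_{\mathfrak{I}_N}(\rho,x)=e^{i\rho x}+\int_{-x}^xK^h_{\mathfrak{I}_N}(x,t)e^{i\rho t}dt$ for all $\rho\in\mathbb{C}$, where $e^h_{\mathfrak{I}_N}(\rho,\cdot)$ is the solution of $\mathbf{L}_{q,\mathfrak{I}_N}u=\rho^2u$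 with $e^h_{\mathfrak{I}_N}(\rho,0)=1$, $(e^h_{\mathfrak{I}_N})'(\rho,0)=i\rho+h$. Such a kernel exists. For $h=f'(0)$ write $K^f_{\mathfrak{I}_N}=K^h_{\mathfrak{I}_N}$, $G^f_{\mathfrak{I}_N}(x,t)=K^f_{\mathfrak{I}_N}(x,t)+K^f_{\mathfrak{I}_N}(x,-t)$, $S_{\mathfrak{I}_N}(x,t)=K^f_{\mathfrak{I}_N}(x,t)-K^f_{\mathfrak{I}_N}(x,-t)$, and $$\mathbf{T}^f_{\mathfrak{I}_N}u(x)=u(x)+\int_{-x}^xK^f_{\mathfrak{I}_N}(x,t)u(t)dt,\quad\mathbf{T}^C_{\mathfrak{I}_N,f}u(x)=u(x)+\int_0^xG^f_{\mathfrak{I}_N}(x,t)u(t)dt,\quad\mathbf{T}^S_{\mathfrak{I}_N}u(x)=u(x)+\int_0^xS_{\mathfrak{I}_N}(x,t)u(t)dt.$$ Formal powers: $\widetilde X^{(0)}\equiv X^{(0)}\equiv1$ and, for $k\in\mathbb{N}$, $\widetilde X^{(k)}(x)=k\int_0^x\widetilde X^{(k-1)}(s)\left(f^2(s)\right)^{(-1)^{k-1}}ds$, $X^{(k)}(x)=k\int_0^xX^{(k-1)}(s)\left(f^2(s)\right)^{(-1)^k}ds$; $\varphi_f^{(k)}=f\widetilde X^{(k)}$ for $k$ even and $\varphi_f^{(k)}=fX^{(k)}$ for $k$ odd. *)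

(* Defs.v *)
From mathcomp Require Import all_boot all_order all_algebra.
From mathcomp Require Import all_classical all_reals all_analysis.
From mathcomp Require Import complex.

Set Implicit Arguments.
Unset Strict Implicit.
Unset Printing Implicit Defensive.

Import Order.TTheory GRing.Theory Num.Theory.
Import numFieldNormedType.Exports.

Local Open Scope classical_set_scope.
Local Open Scope ring_scope.
Local Open Scope complex_scope.

(* Re and Im of Num.Theory are R[i]-valued. *)
Local Notation Re := complex.Re.
Local Notation Im := complex.Im.

(* Functions on [0, b] are total functions R -> R[i] of which only the values
   on [0, b] matter. Limits, derivatives and integrals of complex-valued
   functions are taken on real and imaginary parts. *)

Section ComplexAnalysis.
Variable R : realType.
Implicit Types (a b x : R) (u : R -> R[i]).

Definition cexp (z : R[i]) : R[i] :=
  (expR (Re z))%:C * (cos (Im z) +i* sin (Im z)).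

Definition cintegral (D : set R) u : R[i] :=
  (\int[lebesgue_measure]_(t in D) Re (u t))
    +i* (\int[lebesgue_measure]_(t in D) Im (u t)).

Definition in_L2 a b u : Prop :=
  [/\ measurable_fun `]a, b[ (fun t => Re (u t)),
      measurable_fun `]a, b[ (fun t => Im (u t)) &
      lebesgue_measure.-integrable `]a, b[ (fun t => (Normc.normc (u t) ^+ 2)%:E)].

Definition abs_continuous a b u : Prop :=
  forall eps : R, 0 < eps -> exists2 delta : R, 0 < delta &
    forall (n : nat) (l r : 'I_n -> R),
      (forall i, a <= l i <= r i /\ r i <= b) ->
      (forall i j, i != j -> r i <= l j \/ r j <= l i) ->
      \sum_(i < n) (r i - l i) < delta ->
      \sum_(i < n) Normc.normc (u (r i) - u (l i)) < eps.

(* C_c^1(a, b) *)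
Definition C1_compact_support a b (phi : R -> R) : Prop :=
  [/\ forall x, derivable phi x 1,
      continuous (derive1 phi) &
      exists c d, [/\ a < c, d < b &
        forall x, ~ (c <= x <= d) -> phi x = 0]].

(* Real test functions suffice, also for complex-valued u and v, by
   linearity. *)
Definition is_weak_derivative a b u v : Prop :=
  forall phi, C1_compact_support a b phi ->
    cintegral `]a, b[ (fun t => u t * (derive1 phi t)%:C) =
    - cintegral `]a, b[ (fun t => v t * (phi t)%:C).

Definition is_weak_derivative2 a b u v : Prop :=
  exists w, [/\ in_L2 a b w, is_weak_derivative a b u w &
                is_weak_derivative a b w v].

(* H^2 = W^{2,2} of the open interval (a, b), through weak derivatives. *)
Definition in_H2 a b u : Prop :=
  in_L2 a b u /\ exists2 v, in_L2 a b v & is_weak_derivative2 a b u v.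

Definition cderivable u x : Prop :=
  derivable (fun t => Re (u t)) x 1 /\ derivable (fun t => Im (u t)) x 1.

(* u'(x+) = l *)
Definition deriv_right_limit u x (l : R[i]) : Prop :=
  [/\ \forall y \near x^'+, cderivable u y,
      derive1 (fun t => Re (u t)) y @[y --> x^'+] --> Re l &
      derive1 (fun t => Im (u t)) y @[y --> x^'+] --> Im l].

(* u'(x-) = l *)
Definition deriv_left_limit u x (l : R[i]) : Prop :=
  [/\ \forall y \near x^'-, cderivable u y,
      derive1 (fun t => Re (u t)) y @[y --> x^'-] --> Re l &
      derive1 (fun t => Im (u t)) y @[y --> x^'-] --> Im l].

(* u'(x) = l at the left endpoint x of the domain of u *)
Definition is_right_derivative u x (l : R[i]) : Prop :=
  (Re (u y) - Re (u x)) / (y - x) @[y --> x^'+] --> Re l /\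
  (Im (u y) - Im (u x)) / (y - x) @[y --> x^'+] --> Im l.

End ComplexAnalysis.

Section DeltaInteractions.
Variable R : realType.
Implicit Types (b x t : R).

(* Admissible nodes 0 = xs 0 < xs 1 < ... < xs N < xs N.+1 = b and strengths
   alpha 1, ..., alpha N; other values of xs and alpha are irrelevant. *)
Definition interactions (b : R) (N : nat) (xs : nat -> R)
    (alpha : nat -> R[i]) : Prop :=
  [/\ xs 0%N = 0, xs N.+1 = b,
      forall k, (k <= N)%N -> xs k < xs k.+1 &
      forall k, (1 <= k <= N)%N -> alpha k != 0].

Definition in_D2 (b : R) (N : nat) (xs : nat -> R) (alpha : nat -> R[i])
    (u : R -> R[i]) : Prop :=
  [/\ abs_continuous 0 b u,
      forall k, (k <= N)%N -> in_H2 (xs k) (xs k.+1) u &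
      forall k, (1 <= k <= N)%N -> exists dl dr : R[i],
        [/\ deriv_left_limit u (xs k) dl, deriv_right_limit u (xs k) dr &
            dr - dl = alpha k * u (xs k)]].

(* u solves L u = lam u; in the equation u'' is the weak second derivative,
   which is unique up to null sets. *)
Definition is_solution (q : R -> R[i]) (b : R) (N : nat) (xs : nat -> R)
    (alpha : nat -> R[i]) (lam : R[i]) (u : R -> R[i]) : Prop :=
  in_D2 b N xs alpha u /\
  forall k, (k <= N)%N -> exists u2 : R -> R[i],
    [/\ in_L2 (xs k) (xs k.+1) u2,
        is_weak_derivative2 (xs k) (xs k.+1) u u2 &
        {ae lebesgue_measure, forall t : R, xs k < t < xs k.+1 ->
          - u2 t + q t * u t = lam * u t}].

(* e rho is the solution of L u = rho^2 u with u(0) = 1, u'(0) = i rho + h. *)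
Definition is_e (q : R -> R[i]) (b : R) (N : nat) (xs : nat -> R)
    (alpha : nat -> R[i]) (h : R[i]) (e : R[i] -> R -> R[i]) : Prop :=
  forall rho : R[i],
    [/\ is_solution q b N xs alpha (rho ^+ 2) (e rho), e rho 0 = 1 &
        is_right_derivative (e rho) 0 ('i * rho + h)].

Definition kernel_domain (b : R) : set (R * R) :=
  [set p | 0 < p.1 <= b /\ `|p.2| <= p.1].

Definition in_Linfty_kernel (b : R) (K : R -> R -> R[i]) : Prop :=
  [/\ measurable_fun (kernel_domain b) (fun p => Re (K p.1 p.2)),
      measurable_fun (kernel_domain b) (fun p => Im (K p.1 p.2)) &
      exists M : R, {ae (lebesgue_measure \x lebesgue_measure)%E,
        forall p : R * R, kernel_domain b p -> Normc.normc (K p.1 p.2) <= M}].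

Definition is_transmutation_kernel (b : R) (e : R[i] -> R -> R[i])
    (K : R -> R -> R[i]) : Prop :=
  [/\ in_Linfty_kernel b K,
      forall x, 0 < x <= b -> in_L2 (- x) x (K x) &
      forall (rho : R[i]) x, 0 < x <= b ->
        e rho x = cexp ('i * rho * x%:C) +
          cintegral `[- x, x] (fun t => K x t * cexp ('i * rho * t%:C))].

Definition kernelG (K : R -> R -> R[i]) : R -> R -> R[i] :=
  fun x t => K x t + K x (- t).

Definition kernelS (K : R -> R -> R[i]) : R -> R -> R[i] :=
  fun x t => K x t - K x (- t).

Definition opT (K : R -> R -> R[i]) (u : R -> R[i]) : R -> R[i] :=
  fun x => u x + cintegral `[- x, x] (fun t => K x t * u t).

Definition opTC (K : R -> R -> R[i]) (u : R -> R[i]) : R -> R[i] :=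
  fun x => u x + cintegral `[0, x] (fun t => kernelG K x t * u t).

Definition opTS (K : R -> R -> R[i]) (u : R -> R[i]) : R -> R[i] :=
  fun x => u x + cintegral `[0, x] (fun t => kernelS K x t * u t).

Fixpoint Xtilde (f : R -> R[i]) (k : nat) : R -> R[i] :=
  if k is k'.+1 then
    fun x => k%:R * cintegral `[0, x] (fun s =>
      Xtilde f k' s * (f s ^+ 2) ^ ((-1) ^+ k'))
  else fun=> 1.

Fixpoint Xpow (f : R -> R[i]) (k : nat) : R -> R[i] :=
  if k is k'.+1 then
    fun x => k%:R * cintegral `[0, x] (fun s =>
      Xpow f k' s * (f s ^+ 2) ^ ((-1) ^+ k))
  else fun=> 1.

Definition formal_power (f : R -> R[i]) (k : nat) : R -> R[i] :=
  fun x => f x * (if odd k then Xpow f k x else Xtilde f k x).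

End DeltaInteractions.

(* Main.v *)
Require Import Defs.
From mathcomp Require Import all_boot all_order all_algebra.
From mathcomp Require Import all_classical all_reals all_analysis.
From mathcomp Require Import measurable_realfun complex ring lra.

Set Implicit Arguments.
Unset Strict Implicit.
Unset Printing Implicit Defensive.

Import Order.TTheory GRing.Theory Num.Theory.
Import numFieldNormedType.Exports.

Local Open Scope classical_set_scope.
Local Open Scope ring_scope.
Local Open Scope complex_scope.

Local Notation Re := complex.Re.
Local Notation Im := complex.Im.

(** Fix [x] and write [phi k] for the formal powers and [T k] for the image
    of [t^k] under the transmutation operator. Both families are read off one
    function of a real variable [r], namely the solution [e rho] with
    [i rho = r], as the coefficients of its expansion at [r = 0]:
      [e rho x = \sum_(k < m) r^k / k! * T k x + O(r^m)],
      [e rho x = \sum_(k < m) r^k / k! * phi k x + O(r^m)],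
    and such coefficients are unique ([asymptotic_expansion_unique]).

    The first expansion is that of [exp (r t)] under the integral against the
    integrable function [K x] ([kernel_taylor_bound]).

    The second one comes from the Wronskian [W = f e' - f' e]. At a node the
    derivatives of [f] and [e] jump by [alpha f] and [alpha e], and these jumps
    cancel in [W]; between two nodes [W' = r^2 f e]. Hence
    [W = r + r^2 \int_0^x f e] on the whole of [0, b], and as
    [(e / f)' = W / f^2],
      [e = f (1 + \int_0^x f^-2 (r + r^2 \int_0^s f e))]
    ([solution_quotient]). With [V y = f \int f^-2 \int f y] this reads
    [e = phi 0 + r phi 1 + r^2 V e], while the definition of the formal powers
    gives [phi (k + 2) = (k + 2) (k + 1) V (phi k)] ([formal_powerSS]). So the
    remainder [R m] after [m] terms satisfies [R (m + 2) = r^2 V (R m)]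
    ([taylor_remSS]); since [V] is bounded for the sup norm and [e] is bounded
    on [0, b] uniformly in small [r], the remainder after [2 n] terms is
    [O(r^(2 n))] ([spps_asymptotic]).

    The solutions are only known through weak derivatives. By the lemma of
    du Bois-Reymond a solution is [C^1] on each closed interval between two
    nodes, its derivative being a constant plus a primitive of the weak second
    derivative ([weak_derivative2_C1]). The identity for [W] then follows from
    the product rule for the primitive of an integrable function and a [C^1]
    function, which is an instance of Fubini's theorem ([product_rule_itv]).

    For an even or odd [u], the integral of [K x * u] over [-x, x] folds onto
    [0, x] and becomes the one in the cosine or sine operator ([opT_fold]). *)

(** * Primitives on a compact interval *)

Section RealPrimitives.
Variable R : realType.
Notation mu := (@lebesgue_measure R).
Implicit Types (a b x : R) (u v F G : R -> R).

Lemma continuous_integrable_itv a b u :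
  {within `[a, b], continuous u} -> mu.-integrable `[a, b] (EFin \o u).
Proof. by move=> cu; apply: continuous_compact_integrable => //; exact: segment_compact. Qed.

Lemma integrableM_continuous a b u v : mu.-integrable `[a, b] (EFin \o v) ->
  {within `[a, b], continuous u} ->
  mu.-integrable `[a, b] (EFin \o (fun t => u t * v t)).
Proof.
move=> iv cu; rewrite (_ : _ \o _ = ((EFin \o u) \* (EFin \o v))%E); last first.
  by apply/funext => t.
apply: integrableMr => //.
- by apply: subspace_continuous_measurable_fun => //; exact: measurable_itv.
- have /compact_bounded[M [_ mrt]] :=
    continuous_compact cu (@segment_compact _ a b).
  by exists M; split; rewrite ?num_real // => ? ? ? ?; exact: mrt.
Qed.

Lemma integrableMr_continuous a b u v : mu.-integrable `[a, b] (EFin \o v) ->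
  {within `[a, b], continuous u} ->
  mu.-integrable `[a, b] (EFin \o (fun t => v t * u t)).
Proof.
move=> iv cu; rewrite (_ : _ \o _ = EFin \o (fun t => u t * v t)).
  exact: integrableM_continuous.
by apply/funext => t /=; rewrite mulrC.
Qed.

Lemma within_itvS a b c d u : a <= c -> d <= b ->
  {within `[a, b], continuous u} -> {within `[c, d], continuous u}.
Proof.
move=> ac db; apply: continuous_subspaceW.
by apply: subset_itv; rewrite bnd_simp.
Qed.

Lemma integrable_itvS a b c d u : a <= c -> d <= b ->
  mu.-integrable `[a, b] (EFin \o u) -> mu.-integrable `[c, d] (EFin \o u).
Proof.
move=> ac db; apply: integrableS => //.
by apply: subset_itv; rewrite bnd_simp.
Qed.

(** The derivative is only asked for inside the interval: continuity of [F] and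
    [G] up to the end points makes [G] the one-sided derivative there, and keeps
    the predicate insensitive to the values of [F] outside [[a, b]]. *)
Definition C1 a b F G := [/\ {within `[a, b], continuous F},
  {within `[a, b], continuous G} & {in `]a, b[, forall x, is_derive x 1 F (G x)}].

Lemma C1_FTC a b F G : a <= b -> C1 a b F G ->
  \int[mu]_(t in `[a, b]) G t = F b - F a.
Proof.
rewrite le_eqVlt => /predU1P[<- _|ab [cF cG dF]].
  by rewrite set_itv1 Rintegral_set1 subrr.
rewrite /Rintegral (continuous_FTC2 ab cG (F := F)) //.
  have [_ Fa Fb] := (continuous_within_itvP _ ab).1 cF.
  by split => // x xab; have := dF x xab; case.
by move=> x xab; have := dF x xab; rewrite derive1E => -[].
Qed.

Lemma C1_primitive a b G : a <= b -> {within `[a, b], continuous G} ->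
  C1 a b (fun x => \int[mu]_(t in `[a, x]) G t) G.
Proof.
move=> ab cG; split => //.
  by apply: parameterized_integral_continuous => //; exact: continuous_integrable_itv.
move=> x xab.
have iG := continuous_integrable_itv cG.
have [xb ax] : x < b /\ a < x by move: xab; rewrite in_itv /= => /andP[].
have [|dF <-] := continuous_FTC1_closed xb iG ax.
  apply: within_continuous_continuous xab => //; exact: lt_trans xb.
by rewrite derive1E; exact: DeriveDef.
Qed.

Lemma C1_subitv a b c d F G : a <= c -> d <= b -> C1 a b F G -> C1 c d F G.
Proof.
move=> ac db [cF cG dF]; split; [exact: within_itvS cF|exact: within_itvS cG|].
move=> x; rewrite in_itv /= => /andP[cx xd]; apply: dF.
by rewrite in_itv /= (le_lt_trans ac cx) (lt_le_trans xd db).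
Qed.

Lemma C1_eq a b F u G : {in `[a, b], F =1 u} -> C1 a b F G -> C1 a b u G.
Proof.
move=> Fu [cF cG dF]; split => //.
  by apply: subspace_eq_continuous cF => x; rewrite mem_setE; exact: Fu.
move=> x xab; have := dF x xab; apply: near_eq_is_derive.
have : \forall y \near x, y \in `]a, b[ by exact: near_in_itvoo.
apply: filterS => y yab; apply: Fu; exact: subset_itv_oo_cc yab.
Qed.

Lemma EFin_Rintegral (A : set R) u : measurable A ->
  mu.-integrable A (EFin \o u) ->
  (\int[mu]_(t in A) (u t)%:E)%E = (\int[mu]_(t in A) u t)%:E.
Proof. by move=> mA iu; rewrite /Rintegral fineK//; exact: integrable_fin_num. Qed.

Notation intg a b u := (mu.-integrable `[a, b] (EFin \o u)).

Lemma integrableB_itv a b u v : intg a b u -> intg a b v ->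
  intg a b (fun t => u t - v t).
Proof.
move=> iu iv; rewrite (_ : _ \o _ = (EFin \o u) \- (EFin \o v))%E//.
exact: integrableB.
Qed.

Lemma integrableD_itv a b u v : intg a b u -> intg a b v ->
  intg a b (fun t => u t + v t).
Proof.
move=> iu iv; rewrite (_ : _ \o _ = (EFin \o u) \+ (EFin \o v))%E//.
exact: integrableD.
Qed.

Lemma integrableZ_itv a b u (r : R) : intg a b u -> intg a b (fun t => r * u t).
Proof.
move=> iu; rewrite (_ : _ \o _ = (fun t => r%:E * (EFin \o u) t)%E)//.
exact: integrableZl.
Qed.
End RealPrimitives.

(** * Product rule for the primitive of an integrable function *)

Section ProductRule.
Variable R : realType.
Notation mu := (@lebesgue_measure R).
Implicit Types (a b x : R) (u v F G : R -> R).

(** Both sides are the double integral of [v s * G t] over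
    [a <= s <= t <= b], integrated in the two possible orders. *)
Lemma product_rule_itv a b v F G : a <= b ->
  mu.-integrable `[a, b] (EFin \o v) -> C1 a b F G ->
  \int[mu]_(t in `[a, b]) ((\int[mu]_(s in `[a, t]) v s) * G t)
  = \int[mu]_(s in `[a, b]) v s * F b - \int[mu]_(s in `[a, b]) (v s * F s).
Proof.
move=> ab iv FG; have [cF cG dF] := FG.
(* The triangle s <= t, with p = (t, s). *)
pose A : set (measurableTypeR R * measurableTypeR R) := [set p | p.2 <= p.1].
have mA : measurable A.
  rewrite /A (_ : [set _ | _] = (fun p : measurableTypeR R * measurableTypeR R =>
    p.1 - p.2) @^-1` [set x | 0 <= x]); last first.
    by apply/seteqP; split=> p /=; rewrite subr_ge0.
  rewrite -[X in measurable X]setTI; apply: measurable_funB => //.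
  by rewrite -set_itvcy; exact: measurable_itv.
pose v' := v \_ `[a, b]; pose G' := G \_ `[a, b].
have iv' : mu.-integrable setT (EFin \o v').
  by rewrite -restrict_EFin; apply/integrable_restrict => //; rewrite setTI.
have iG' : mu.-integrable setT (EFin \o G').
  rewrite -restrict_EFin; apply/integrable_restrict => //; rewrite setTI.
  exact: continuous_integrable_itv.
pose h (p : measurableTypeR R * measurableTypeR R) : \bar R :=
  (G' p.1 * v' p.2 * \1_A p)%:E.
have mh : measurable_fun setT h.
  apply/measurable_EFinP; apply: measurable_funM; last exact: measurable_indic.
  apply: measurable_funM.
    apply: (@measurableT_comp _ _ _ _ _ _ G' _ fst) => //.
    by apply/measurable_EFinP; exact: measurable_int iG'.
  apply: (@measurableT_comp _ _ _ _ _ _ v' _ snd) => //.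
  by apply/measurable_EFinP; exact: measurable_int iv'.
have E1 t : (\int[mu]_s h (t, s) =
    (((fun x => (\int[mu]_(s in `[a, x]) v s) * G x) \_ `[a, b]) t)%:E)%E.
  rewrite patchE; case: ifPn => tab; last first.
    apply: integral0_eq => s _; rewrite /h /G' patchE /= (negbTE tab).
    by rewrite !mul0r.
  have /andP[a_t tb] : a <= t <= b by move: tab; rewrite inE /= in_itv.
  have -> : (fun s => h (t, s)) =
      (fun s => (G t * (v \_ `[a, t]) s)%:E) :> (R -> \bar R).
    apply/funext => s; rewrite /h /A /G' /v' !patchE /= tab indicE.
    have -> : ((t, s) \in [set p : measurableTypeR R * measurableTypeR R | p.2 <= p.1])
        = (s <= t) by apply/idP/idP; rewrite inE.
    rewrite !mem_setE !in_itv /=.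
    have [sa|sa] := leP a s; rewrite /= ?mulr0 ?mul0r//.
    have [st|st] := leP s t; last by rewrite !mulr0.
    by rewrite (le_trans st tb) mulr1.
  have ivt : mu.-integrable setT (EFin \o (v \_ `[a, t])).
    rewrite -restrict_EFin; apply/integrable_restrict => //.
    by rewrite setTI; exact: integrable_itvS iv.
  rewrite EFin_Rintegral; [|exact: measurableT|].
    congr EFin; rewrite mulrC [in RHS]Rintegral_mkcond.
    exact: RintegralZl.
  rewrite (_ : _ \o _ = (fun s => (G t)%:E * (EFin \o (v \_ `[a, t])) s)%E)//.
  exact: integrableZl.
have E2 s : (\int[mu]_t h (t, s) =
    (((fun x => (F b - F x) * v x) \_ `[a, b]) s)%:E)%E.
  rewrite patchE; case: ifPn => sab; last first.
    apply: integral0_eq => t _; rewrite /h /v' patchE /= (negbTE sab).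
    by rewrite mulr0 mul0r.
  have /andP[a_s sb] : a <= s <= b by move: sab; rewrite inE /= in_itv.
  have -> : (fun t => h (t, s)) =
      (fun t => (v s * (G \_ `[s, b]) t)%:E) :> (R -> \bar R).
    apply/funext => t; rewrite /h /A /G' /v' !patchE /= sab indicE.
    have -> : ((t, s) \in [set p : measurableTypeR R * measurableTypeR R | p.2 <= p.1])
        = (s <= t) by apply/idP/idP; rewrite inE.
    rewrite !mem_setE !in_itv /=.
    have [st|st] := leP s t; rewrite /= ?mulr0// (le_trans a_s st) /= mulr1 mulrC.
    by case: ifP.
  have iGt : mu.-integrable setT (EFin \o (G \_ `[s, b])).
    rewrite -restrict_EFin; apply/integrable_restrict => //.
    by rewrite setTI; apply: continuous_integrable_itv; exact: within_itvS cG.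
  rewrite EFin_Rintegral; [|exact: measurableT|].
    congr EFin; rewrite mulrC -(C1_FTC sb (C1_subitv a_s (lexx b) FG)).
    rewrite [in RHS]Rintegral_mkcond.
    exact: RintegralZl.
  rewrite (_ : _ \o _ = (fun t => (v s)%:E * (EFin \o (G \_ `[s, b])) t)%E)//.
  exact: integrableZl.
have ih : (mu \x mu)%E.-integrable setT h.
  pose k (p : measurableTypeR R * measurableTypeR R) : \bar R :=
    (G' p.1 * v' p.2)%:E.
  have mk : measurable_fun setT k.
    apply/measurable_EFinP; apply: measurable_funM.
      apply: (@measurableT_comp _ _ _ _ _ _ G' _ fst) => //.
      by apply/measurable_EFinP; exact: measurable_int iG'.
    apply: (@measurableT_comp _ _ _ _ _ _ v' _ snd) => //.
    by apply/measurable_EFinP; exact: measurable_int iv'.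
  apply: (@le_integrable _ _ _ _ _ _ _ k) => //.
    move=> [t s] _; rewrite /h /k /= lee_fin normrM ler_piMr// indicE.
    by case: (_ \in _); rewrite ?normr1 ?normr0.
  apply/(@integrable12ltyP _ _ _ _ _ mu mu k mk).
  have av := integrable_abse iv'.
  have ag := integrable_abse iG'.
  rewrite /k /=; under eq_integral => t _.
    rewrite (_ : (fun y => _) = fun y => `|(G' t)%:E| * `|(v' y)%:E|)%E; last first.
      by apply/funext => y; rewrite -abseM.
    rewrite ge0_integralZl//; last by case/integrableP: av.
  over.
  rewrite /= ge0_integralZr//; last 2 first.
    by case/integrableP: ag.
    exact: integral_ge0.
  by case/integrableP: iv' => _ ?; case/integrableP: iG' => _ ?;
     rewrite lte_mul_pinfty ?integral_ge0// ge0_fin_numE ?integral_ge0.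
have := Fubini ih; clear ih.
under eq_integral do rewrite E1.
under [in X in _ = X -> _]eq_integral do rewrite E2.
move=> /(congr1 fine); rewrite -/(Rintegral _ _ _) -/(Rintegral _ _ _).
rewrite -!Rintegral_mkcond => ->; clear -iv cF.
under eq_Rintegral do rewrite mulrBl.
rewrite RintegralB.
- rewrite RintegralZl// mulrC; congr (_ - _).
  by apply: eq_Rintegral => s _; rewrite mulrC.
- exact: measurable_itv.
- exact: integrableZ_itv.
- exact: integrableM_continuous.
Qed.
End ProductRule.

(** * Test functions *)

Section TestFunctions.
Variable R : realType.
Notation mu := (@lebesgue_measure R).
Notation intg a b u := (mu.-integrable `[a, b] (EFin \o u)).
Implicit Types (a b x : R) (u v F G : R -> R).

(** The primitive of [G] is squeezed between its values [0] and [0] at the two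
    end points, so its derivative vanishes. *)
Lemma continuous_integral_eq0 a b G : {within `[a, b], continuous G} ->
  {in `[a, b], forall x, 0 <= G x} -> \int[mu]_(t in `[a, b]) G t = 0 ->
  {in `]a, b[, forall x, G x = 0}.
Proof.
move=> cG G0 I0 x xab.
have ab : a <= b by move: xab; rewrite in_itv /= => /andP[? ?]; apply: ltW; apply: lt_trans; eassumption.
have iG := continuous_integrable_itv cG.
have P0 y : y \in `[a, b] -> \int[mu]_(t in `[a, y]) G t = 0.
  rewrite in_itv /= => /andP[ay yb]; apply/eqP; rewrite eq_le; apply/andP; split; last first.
    apply: Rintegral_ge0 => t /=; rewrite in_itv /= => /andP[a_t ty]; apply: G0.
    by rewrite in_itv /= a_t (le_trans ty yb).
  rewrite -I0 -subr_ge0 Rintegral_itvB//.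
  apply: Rintegral_ge0 => t /=; rewrite in_itv /= => /andP[yt tb]; apply: G0.
  by rewrite in_itv /= tb (le_trans ay (ltW yt)).
have [_ _ dF] := C1_eq (u := cst 0) P0 (C1_primitive ab cG).
have := dF x xab; have := is_derive_cst (0 : R) x (1 : R).
by case=> _ e1 [_ e2]; rewrite -e2 -[RHS]e1.
Qed.

(** As a maximum of two continuous functions, this parabolic arc is continuous
    on the line without any gluing at [a] and [b]. *)
Definition pbump a b t : R := Num.max 0 ((t - a) * (b - t)).

Lemma pbump_out a b t : ~~ (a <= t <= b) -> a <= b -> pbump a b t = 0.
Proof.
rewrite negb_and -!ltNge => /orP[ta|bt] ab; rewrite /pbump; apply/max_idPl.
  by rewrite nmulr_rle0 ?subr_lt0// subr_ge0 (le_trans (ltW ta)).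
by rewrite pmulr_rle0 ?subr_gt0 ?subr_le0 ?(le_lt_trans ab)// ltW.
Qed.

Lemma pbump_gt0 a b t : a < t < b -> 0 < pbump a b t.
Proof. by case/andP=> a_t tb; rewrite lt_max mulr_gt0 ?orbT// subr_gt0. Qed.

Lemma pbump_ge0 a b t : 0 <= pbump a b t.
Proof. by rewrite le_max lexx. Qed.

Lemma continuous_pbump a b : continuous (pbump a b).
Proof.
move=> x; apply: (@continuous_max _ _ (cst 0) (fun t => (t - a) * (b - t))).
  exact: cvg_cst.
apply: cvgM; apply: cvgB => //; first exact: cvg_cst.
exact: cvg_cst.
Qed.

Definition vanishes_outside c d (p : R -> R) := forall x, ~ (c <= x <= d) -> p x = 0.

(** The primitive vanishes on the left of the support trivially, and on the
    right because the total integral is zero. It starts from [a - 1] rather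
    than [a] so that it is differentiable at [a] as well. *)
Lemma compact_support_primitive a b c d (theta : R -> R) : a < c -> d < b ->
  continuous theta -> vanishes_outside c d theta ->
  \int[mu]_(t in `[a, b]) theta t = 0 ->
  exists2 phi, C1_compact_support a b phi & derive1 phi = theta.
Proof.
move=> ac db ct st It.
pose phi x := \int[mu]_(t in `[a - 1, x]) theta t.
have ith y : intg (a - 1) y theta.
  by apply: continuous_integrable_itv; exact: continuous_subspaceT.
have phi0 x : x < c -> phi x = 0.
  move=> xc; rewrite /phi; transitivity (\int[mu]_(t in `[a - 1, x]) (cst 0 t : R)).
    apply: eq_Rintegral => t; rewrite mem_setE in_itv /= => /andP[_ tx].
    by rewrite st// => /andP[ct' _]; move: (le_lt_trans tx xc); rewrite ltNge ct'.
  by rewrite Rintegral_cst// mul0r.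
have dphi x : is_derive x 1 phi (theta x).
  have [xa|ax] := ltP x a.
    have -> : theta x = 0.
      by apply: st => /andP[cx _]; have := lt_trans xa ac; rewrite ltNge cx.
    apply: (@near_eq_is_derive _ _ _ (cst 0)).
    near=> y; rewrite phi0//; apply: (@lt_trans _ _ a) => //; near: y.
    exact: lt_nbhsl.
  have ax1 : a - 1 < x by rewrite (lt_le_trans _ ax)// gtrBl.
  have x1 : x < x + 1 by rewrite ltrDl.
  have [|? <-] := continuous_FTC1_closed x1 (ith (x + 1)) ax1; first exact: ct.
  by rewrite derive1E; exact: DeriveDef.
have dE : derive1 phi = theta.
  by apply/funext => x; rewrite derive1E; exact: derive_val.
exists phi => //; split; [by move=> x; have [] := dphi x| by rewrite dE|].
exists c, d; split => // x /negP; rewrite negb_and -!ltNge => /orP[/phi0//|dx].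
rewrite /phi -It Rintegral_mkcond [RHS]Rintegral_mkcond.
apply: eq_Rintegral => t _; rewrite !patchE !mem_setE.
have [|n] := boolP (c <= t <= d); last by rewrite st; [rewrite !if_same|exact/negP].
case/andP => ct' td; rewrite !in_itv /= (ltW (le_lt_trans td dx)) (ltW (le_lt_trans td db)).
by rewrite (ltW (lt_le_trans ac ct')) (le_trans _ (ltW (lt_le_trans ac ct')))// gerBl.
Unshelve. all: by end_near. Qed.

End TestFunctions.

(** * The lemma of du Bois-Reymond *)

Section TestedByContinuous.
Variable R : realType.
Notation mu := (@lebesgue_measure R).
Notation intg a b u := (mu.-integrable `[a, b] (EFin \o u)).
Implicit Types (a b x : R) (u v F G : R -> R).

Definition weak_derivative_on a b u v := forall phi, C1_compact_support a b phi ->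
  \int[mu]_(t in `[a, b]) (u t * derive1 phi t) =
  - \int[mu]_(t in `[a, b]) (v t * phi t).

(** Subtracting from a continuous function the multiple of a fixed bump with
    the same integral leaves the derivative of a test function. So integration
    against [z] and integration are proportional functionals on the continuous
    functions with compact support. *)
Lemma weak_derivative0_cst a b z : a < b -> intg a b z ->
  weak_derivative_on a b z (cst 0) ->
  exists c0, forall c d p, a < c -> d < b -> continuous p -> vanishes_outside c d p ->
    \int[mu]_(t in `[a, b]) (z t * p t) = c0 * \int[mu]_(t in `[a, b]) p t.
Proof.
move=> ab iz wz.
(* The middle third of [a, b] supports the fixed bump. *)
pose c1 := a + (b - a) / 3; pose d1 := b - (b - a) / 3.
have ba3 : 0 < (b - a) / 3 by rewrite divr_gt0// subr_gt0.
have ac1 : a < c1 by rewrite ltrDl.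
have db1 : d1 < b by rewrite gtrBl.
have cd1 : c1 < d1 by rewrite /c1 /d1; lra.
pose p0 : R -> R := pbump c1 d1.
have cp0 : continuous p0 by exact: continuous_pbump.
have vp0 : vanishes_outside c1 d1 p0.
  by move=> x /negP/pbump_out; apply; exact: ltW.
have intc (p : R -> R) : continuous p -> intg a b p.
  by move=> cp; apply: continuous_integrable_itv; exact: continuous_subspaceT.
have intz (p : R -> R) : continuous p -> intg a b (fun t => z t * p t).
  by move=> cp; apply: integrableMr_continuous => //; exact: continuous_subspaceT.
pose I0 := \int[mu]_(t in `[a, b]) p0 t.
have I0_neq0 : I0 != 0.
  apply/eqP => I00.
  have m_ab : (c1 + d1) / 2 \in `]a, b[ by rewrite in_itv /=; apply/andP; split; lra.
  have p0_ge0 : {in `[a, b], forall x, 0 <= p0 x} by move=> x _; exact: pbump_ge0.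
  have := continuous_integral_eq0 (continuous_subspaceT cp0) p0_ge0 I00 m_ab.
  by apply/eqP; rewrite gt_eqF//; apply: pbump_gt0; apply/andP; split; lra.
exists (\int[mu]_(t in `[a, b]) (z t * p0 t) / I0) => c d p ac db cp vp.
pose k := \int[mu]_(t in `[a, b]) p t / I0.
pose theta t := p t - k * p0 t.
have ct : continuous theta.
  by move=> x; apply: cvgB; [exact: cp|apply: cvgM; [exact: cvg_cst|exact: cp0]].
have vt : vanishes_outside (Num.min c c1) (Num.max d d1) theta.
  move=> x; rewrite ge_min le_max => nx; rewrite /theta vp ?vp0 ?mulr0 ?subr0//.
    by move=> /andP[cx xd]; apply: nx; rewrite cx xd !orbT.
  by move=> /andP[cx xd]; apply: nx; rewrite cx xd.
have kp0 : intg a b (fun t => k * p0 t) by exact/integrableZ_itv/intc.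
have t0 : \int[mu]_(t in `[a, b]) theta t = 0.
  rewrite /theta RintegralB//; last exact: intc.
  by rewrite RintegralZl//; [rewrite -/I0 divfK// subrr|exact: intc].
have ac' : a < Num.min c c1 by rewrite lt_min ac.
have db' : Num.max d d1 < b by rewrite gt_max db.
have [phi phiC dphi] := compact_support_primitive ac' db' ct vt t0.
have := wz phi phiC; rewrite dphi /cst.
under [in X in _ = - X]eq_Rintegral do rewrite mul0r.
rewrite Rintegral_cst// mul0r oppr0 => z0.
have -> : \int[mu]_(t in `[a, b]) (z t * p t) =
   \int[mu]_(t in `[a, b]) (z t * theta t + k * (z t * p0 t)).
  by apply: eq_Rintegral => t _; rewrite /theta; ring.
have izp0 := intz _ cp0; have izt := intz _ ct.
rewrite RintegralD//; last exact: integrableZ_itv.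
by rewrite z0 add0r RintegralZl// /k mulrC [RHS]mulrAC mulrA.
Qed.

Lemma continuous_clamp a b u : a <= b -> {within `[a, b], continuous u} ->
  continuous (fun t => u (Num.max a (Num.min b t))).
Proof.
move=> ab cu x.
have cl : continuous (fun t : R => Num.max a (Num.min b t)).
  move=> y; apply: (@continuous_max _ _ (cst a) (fun t => Num.min b t)).
    exact: cvg_cst.
  by apply: (@continuous_min _ _ (cst b) id); [exact: cvg_cst|exact: cvg_id].
have cab y : a <= Num.max a (Num.min b y) <= b.
  by rewrite le_max lexx /= ge_max ab ge_min lexx.
move: cu => /subspace_continuousP cu.
have clx : `[a, b]%classic (Num.max a (Num.min b x)) by rewrite /= in_itv; exact: cab.
apply: (@cvg_comp _ _ _ (fun t => Num.max a (Num.min b t)) u _ _ _ _ (cu _ clx)) => P hP.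
have := cl x _ hP; apply: (@filterS _ (nbhs x)) => y; apply.
by rewrite /= in_itv; exact: cab.
Qed.

(** Testing with [z - c0] times a bump turns the integral into that of a
    nonnegative continuous function, which has to vanish. *)
Lemma continuous_weak_derivative0_cst a b z : a < b -> {within `[a, b], continuous z} ->
  weak_derivative_on a b z (cst 0) -> {in `[a, b] &, forall x y, z x = z y}.
Proof.
move=> ab cz wz.
have iz := continuous_integrable_itv cz.
have [c0 H] := weak_derivative0_cst ab iz wz.
suff inside : {in `]a, b[, forall x, z x = c0}.
  have [_ za zb] := (continuous_within_itvP _ ab).1 cz.
  suff all : {in `[a, b], forall x, z x = c0} by move=> x y xab yab; rewrite !all.
  move=> x; rewrite in_itv /= => /andP[]; rewrite le_eqVlt => /predU1P[<- _|ax].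
    apply: (cvg_unique _ za) => //; apply: cvg_near_cst.
    near=> t; apply: inside; rewrite in_itv /=; apply/andP; split; near: t.
      exact: nbhs_right_gt.
    exact: nbhs_right_lt.
  rewrite le_eqVlt => /predU1P[->|xb]; last by apply: inside; rewrite in_itv /= ax.
  apply: (cvg_unique _ zb) => //; apply: cvg_near_cst.
  near=> t; apply: inside; rewrite in_itv /=; apply/andP; split; near: t.
    exact: nbhs_left_gt.
  exact: nbhs_left_lt.
move=> x; rewrite in_itv /= => /andP[ax xb].
pose p := (a + x) / 2; pose q := (x + b) / 2.
have ap : a < p by rewrite /p; lra.
have px : p < x by rewrite /p; lra.
have xq : x < q by rewrite /q; lra.
have qb : q < b by rewrite /q; lra.
(* Test functions live on the whole line, hence the extension of z by constants. *)
pose zc t := z (Num.max a (Num.min b t)).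
have czc : continuous zc by apply: continuous_clamp => //; exact: ltW.
have zcE t : t \in `[a, b] -> zc t = z t.
  by rewrite in_itv /= /zc => /andP[a_t tb]; congr z; rewrite (min_idPr tb) (max_idPr a_t).
pose y t := (zc t - c0) * pbump p q t.
have cy : continuous y.
  move=> t; apply: cvgM; last exact: continuous_pbump.
  by apply: cvgB; [exact: czc|exact: cvg_cst].
have vy : vanishes_outside p q y.
  by move=> t /negP nt; rewrite /y pbump_out ?mulr0//; apply: ltW; exact: lt_trans xq.
have Hy := H p q y ap qb cy vy.
have iy : intg a b y.
  by apply: continuous_integrable_itv; exact: continuous_subspaceT.
pose g t := (zc t - c0) * y t.
have cg : continuous g.
  by move=> t; apply: cvgM; [apply: cvgB; [exact: czc|exact: cvg_cst]|exact: cy].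
have g0 : {in `[a, b], forall t, 0 <= g t}.
  by move=> t _; rewrite /g /y mulrA -expr2 mulr_ge0 ?sqr_ge0 ?pbump_ge0.
have Ig : \int[mu]_(t in `[a, b]) g t = 0.
  have -> : \int[mu]_(t in `[a, b]) g t =
            \int[mu]_(t in `[a, b]) (y t * z t - c0 * y t).
    apply: eq_Rintegral => t; rewrite mem_setE => tab.
    by rewrite /g zcE// mulrBl [z t * _]mulrC.
  rewrite RintegralB//; last first.
  - exact: integrableZ_itv.
  - by apply: integrableM_continuous => //; exact: continuous_subspaceT.
  rewrite RintegralZl// -Hy -[RHS](subrr (\int[mu]_(t in `[a, b]) (z t * y t))).
  by congr (_ - _); apply: eq_Rintegral => t _; rewrite mulrC.
have xab : x \in `]a, b[ by rewrite in_itv /= ax.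
have := continuous_integral_eq0 (continuous_subspaceT cg) g0 Ig xab.
move=> /eqP; rewrite /g /y zcE ?in_itv /= ?(ltW ax) ?(ltW xb)// mulrA mulf_eq0.
rewrite (gt_eqF (pbump_gt0 _)) ?px ?xq// orbF -expr2 sqrf_eq0 subr_eq0.
by move/eqP.
Unshelve. all: by end_near. Qed.

End TestedByContinuous.

(** * Regularity from weak derivatives *)

Section WeakRegularity.
Variable R : realType.
Notation mu := (@lebesgue_measure R).
Notation intg a b u := (mu.-integrable `[a, b] (EFin \o u)).
Implicit Types (a b x : R) (u v F G : R -> R).

Lemma test_function_C1 a b phi : C1_compact_support a b phi ->
  [/\ C1 a b phi (derive1 phi), phi b = 0 & continuous phi].
Proof.
move=> [dphi cdphi [c [d [ac db vphi]]]].
have cphi : continuous phi.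
  by move=> x; apply: differentiable_continuous; apply/derivable1_diffP.
split; [|by apply: vphi => /andP[_ bd]; have := lt_le_trans db bd; rewrite ltxx|exact: cphi].
split; [exact: continuous_subspaceT|exact: continuous_subspaceT|].
by move=> x _; rewrite derive1E; exact: DeriveDef.
Qed.

(** Integration by parts, that is the product rule applied to a function
    vanishing at both end points. *)
Lemma weak_derivative_primitive a b v (c : R) : a <= b -> intg a b v ->
  weak_derivative_on a b (fun x => c + \int[mu]_(t in `[a, x]) v t) v.
Proof.
move=> ab iv phi phiC; have [phi1 phib cphi] := test_function_C1 phiC.
have cV := parameterized_integral_continuous ab iv.
have [_ cdphi _] := phi1.
have phia : phi a = 0.
  case: phiC => _ _ [c' [d [ac db vphi]]].
  by apply: vphi => /andP[ca _]; have := lt_le_trans ac ca; rewrite ltxx.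
under eq_Rintegral do rewrite mulrDl.
rewrite RintegralD//; last 2 first.
- exact/integrableZ_itv/continuous_integrable_itv.
- by apply: integrableM_continuous => //; exact: continuous_integrable_itv.
rewrite RintegralZl//; last exact: continuous_integrable_itv.
rewrite (C1_FTC ab phi1) phib phia subrr mulr0 add0r.
by rewrite (product_rule_itv ab iv phi1) phib mulr0 sub0r.
Qed.

Lemma weak_derivative_onB a b u1 v1 u2 v2 :
  intg a b u1 -> intg a b v1 -> intg a b u2 -> intg a b v2 ->
  weak_derivative_on a b u1 v1 -> weak_derivative_on a b u2 v2 ->
  weak_derivative_on a b (fun t => u1 t - u2 t) (fun t => v1 t - v2 t).
Proof.
move=> iu1 iv1 iu2 iv2 w1 w2 phi phiC; have [[cphi cdphi _] _ _] := test_function_C1 phiC.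
under eq_Rintegral do rewrite mulrBl.
under [in RHS]eq_Rintegral do rewrite mulrBl.
rewrite RintegralB//; [|exact: integrableMr_continuous..].
rewrite RintegralB//; [|exact: integrableMr_continuous..].
by rewrite w1// w2// opprB opprK addrC.
Qed.

Lemma eq_weak_derivative a b u v v' : (forall phi, C1_compact_support a b phi ->
    \int[mu]_(t in `[a, b]) (v t * phi t) = \int[mu]_(t in `[a, b]) (v' t * phi t)) ->
  weak_derivative_on a b u v -> weak_derivative_on a b u v'.
Proof. by move=> vv w phi phiC; rewrite -vv// w. Qed.

(** The function [u] minus the primitive of [v] is continuous and has a zero
    weak derivative. *)
Lemma weak_derivative_FTC a b u v : a < b -> {within `[a, b], continuous u} ->
  intg a b v -> weak_derivative_on a b u v ->
  {in `[a, b], forall x, u x = u a + \int[mu]_(t in `[a, x]) v t}.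
Proof.
move=> ab cu iv w x xab.
have wV := weak_derivative_primitive 0 (ltW ab) iv.
have cV := parameterized_integral_continuous (ltW ab) iv.
pose V t := 0 + \int[mu]_(s in `[a, t]) v s.
have cV0 : {within `[a, b], continuous V}.
  by move=> t; apply: cvgD; [exact: cvg_cst|exact: cV].
pose z t := u t - V t.
have cz : {within `[a, b], continuous z} by move=> t; apply: cvgB; [exact: cu|exact: cV0].
have wz : weak_derivative_on a b z (cst 0).
  apply: eq_weak_derivative (weak_derivative_onB _ iv _ iv w wV).
  - by move=> phi _; apply: eq_Rintegral => t _; rewrite subrr.
  - exact: continuous_integrable_itv.
  - exact: continuous_integrable_itv.
have aab : a \in `[a, b] by rewrite in_itv /= lexx ltW.
have := continuous_weak_derivative0_cst ab cz wz xab aab.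
rewrite /z /V !add0r set_itv1 Rintegral_set1 subr0 => <-.
by rewrite subrK.
Qed.

(** The first derivative [w] is only integrable, hence it is compared with the
    primitive of [v] through test functions: [w] and a continuous function [g]
    act alike on them, so that [g] is a weak derivative of [u] as well. *)
Lemma weak_derivative2_C1 a b u w v : a < b -> {within `[a, b], continuous u} ->
  intg a b w -> intg a b v -> weak_derivative_on a b u w ->
  weak_derivative_on a b w v ->
  exists c : R, C1 a b u (fun x => c + \int[mu]_(t in `[a, x]) v t).
Proof.
move=> ab cu iw iv wu ww.
pose V t := 0 + \int[mu]_(s in `[a, t]) v s.
have wV := weak_derivative_primitive 0 (ltW ab) iv.
have cV := parameterized_integral_continuous (ltW ab) iv.
have cV0 : {within `[a, b], continuous V}.
  by move=> t; apply: cvgD; [exact: cvg_cst|exact: cV].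
have iV := continuous_integrable_itv cV0.
have wz : weak_derivative_on a b (fun t => w t - V t) (cst 0).
  apply: eq_weak_derivative (weak_derivative_onB iw iv iV iv ww wV).
  by move=> phi _; apply: eq_Rintegral => t _; rewrite subrr.
have [c H] := weak_derivative0_cst ab (integrableB_itv iw iV) wz.
exists c; pose g t := c + \int[mu]_(s in `[a, t]) v s.
have cg : {within `[a, b], continuous g}.
  by move=> t; apply: cvgD; [exact: cvg_cst|exact: cV].
have ig := continuous_integrable_itv cg.
have wg : weak_derivative_on a b u g.
  apply: eq_weak_derivative wu => phi phiC.
  have [_ _ [c1 [d1 [ac1 db1 vphi]]]] := phiC.
  have [[cphiab _ _] _ cphi] := test_function_C1 phiC.
  have iphi := continuous_integrable_itv cphiab.
  have := H c1 d1 phi ac1 db1 cphi vphi => E.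
  apply/eqP; rewrite -subr_eq0; apply/eqP.
  have ig1 := integrableMr_continuous iw cphiab.
  have ig2 := integrableMr_continuous ig cphiab.
  rewrite -RintegralB//.
  transitivity (\int[mu]_(t in `[a, b]) ((w t - V t) * phi t - c * phi t)).
    by apply: eq_Rintegral => t _; rewrite /g /V; ring.
  rewrite RintegralB//; last 2 first.
  - by apply: integrableMr_continuous => //; exact: integrableB_itv.
  - exact: integrableZ_itv.
  by rewrite E RintegralZl// subrr.
apply: (C1_eq (F := fun x => u a + \int[mu]_(t in `[a, x]) g t)).
  by move=> x xab; rewrite (weak_derivative_FTC ab cu ig wg xab).
have [cU _ dU] := C1_primitive (ltW ab) cg.
split => //; first by move=> t; apply: cvgD; [exact: cvg_cst|exact: cU].
move=> x xab; rewrite -[X in is_derive _ _ _ X]add0r.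
by have ? := dU x xab; apply: is_deriveD.
Qed.

End WeakRegularity.

(** * Calculus of complex-valued functions *)

Section ComplexCalculus.
Variable R : realType.
Notation mu := (@lebesgue_measure R).
Notation intg a b u := (mu.-integrable `[a, b] (EFin \o u)).
Implicit Types (a b x : R) (u v F G : R -> R[i]) (z w : R[i]).

Lemma cReD z w : Re (z + w) = Re z + Re w. Proof. by case: z; case: w. Qed.
Lemma cImD z w : Im (z + w) = Im z + Im w. Proof. by case: z; case: w. Qed.
Lemma cReN z : Re (- z) = - Re z. Proof. by case: z. Qed.
Lemma cImN z : Im (- z) = - Im z. Proof. by case: z. Qed.
Lemma cReB z w : Re (z - w) = Re z - Re w. Proof. by case: z; case: w. Qed.
Lemma cImB z w : Im (z - w) = Im z - Im w. Proof. by case: z; case: w. Qed.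
Lemma cReM z w : Re (z * w) = Re z * Re w - Im z * Im w.
Proof. by case: z; case: w. Qed.
Lemma cImM z w : Im (z * w) = Re z * Im w + Im z * Re w.
Proof. by case: z; case: w. Qed.
Lemma cReV z : Re z^-1 = Re z / (Re z ^+ 2 + Im z ^+ 2).
Proof. by case: z. Qed.
Lemma cImV z : Im z^-1 = - Im z / (Re z ^+ 2 + Im z ^+ 2).
Proof. by case: z => a b; rewrite /= mulNr. Qed.
Definition ReIm := (cReD, cImD, cReN, cImN, cReM, cImM).
Lemma complex_eq z w : Re z = Re w -> Im z = Im w -> z = w.
Proof. by case: z => ? ?; case: w => ? ? /= -> ->. Qed.

Lemma sum_sqr_neq0 z : z != 0 -> Re z ^+ 2 + Im z ^+ 2 != 0.
Proof.
case: z => x y; rewrite eq_complex /= negb_and => xy.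
by rewrite paddr_eq0 ?sqr_ge0// negb_and !sqrf_eq0.
Qed.

Definition ccont a b u := {within `[a, b], continuous (fun t => Re (u t))} /\
  {within `[a, b], continuous (fun t => Im (u t))}.

Definition cintg a b u := intg a b (fun t => Re (u t)) /\ intg a b (fun t => Im (u t)).

Definition cC1 a b F G := C1 a b (fun t => Re (F t)) (fun t => Re (G t)) /\
  C1 a b (fun t => Im (F t)) (fun t => Im (G t)).

Lemma ccont_cst a b z : ccont a b (cst z).
Proof. by split => t; exact: cvg_cst. Qed.

Lemma ccontD a b u v : ccont a b u -> ccont a b v -> ccont a b (fun t => u t + v t).
Proof.
move=> [u1 u2] [v1 v2]; split.
  by rewrite (funext (fun t => cReD (u t) (v t))) => t; apply: cvgD; [exact: u1|exact: v1].
by rewrite (funext (fun t => cImD (u t) (v t))) => t; apply: cvgD; [exact: u2|exact: v2].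
Qed.

Lemma ccontM a b u v : ccont a b u -> ccont a b v -> ccont a b (fun t => u t * v t).
Proof.
move=> [u1 u2] [v1 v2]; split.
  rewrite (funext (fun t => cReM (u t) (v t))) => t.
  by apply: cvgB; apply: cvgM; [exact: u1|exact: v1|exact: u2|exact: v2].
rewrite (funext (fun t => cImM (u t) (v t))) => t.
by apply: cvgD; apply: cvgM; [exact: u1|exact: v2|exact: u2|exact: v1].
Qed.

Lemma ccontV a b u : (forall t, t \in `[a, b] -> u t != 0) -> ccont a b u ->
  ccont a b (fun t => (u t)^-1).
Proof.
move=> u0 [cu1 cu2].
pose D t := Re (u t) ^+ 2 + Im (u t) ^+ 2.
have cD : {within `[a, b], continuous D}.
  by move=> t; apply: cvgD; apply: cvgM; [exact: cu1|exact: cu1|exact: cu2|exact: cu2].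
have cDV : {within `[a, b], continuous (fun t => (D t)^-1)}.
  apply/subspace_continuousP => t tab.
  apply: cvgV; first exact/sum_sqr_neq0/u0.
  by move/subspace_continuousP: cD; apply.
split.
  by rewrite (funext (fun t => cReV (u t))) => t; apply: cvgM; [exact: cu1|exact: cDV].
rewrite (funext (fun t => cImV (u t))) => t; apply: cvgM; [|exact: cDV].
by apply: cvgN; exact: cu2.
Qed.

Lemma ccont_sqrV a b u : (forall t, t \in `[a, b] -> u t != 0) -> ccont a b u ->
  ccont a b (fun t => (u t ^+ 2)^-1).
Proof.
move=> u0 cu; rewrite (_ : (fun _ => _) = (fun t => (u t)^-1 * (u t)^-1)).
  by apply: ccontM; exact: ccontV.
by apply/funext => t; rewrite expr2 invfM.
Qed.

Lemma ccont_subitv a b c d u : a <= c -> d <= b -> ccont a b u -> ccont c d u.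
Proof. by move=> ac db [? ?]; split; exact: (within_itvS ac db). Qed.

Lemma ccont_intg a b u : ccont a b u -> cintg a b u.
Proof. by case=> ? ?; split; exact: continuous_integrable_itv. Qed.

Lemma cintg_subitv a b c d u : a <= c -> d <= b -> cintg a b u -> cintg c d u.
Proof. by move=> ac db [? ?]; split; exact: (integrable_itvS ac db). Qed.

Lemma cintgD a b u v : cintg a b u -> cintg a b v -> cintg a b (fun t => u t + v t).
Proof.
move=> [? ?] [? ?]; split;
  [rewrite (funext (fun t => cReD (u t) (v t)))
  |rewrite (funext (fun t => cImD (u t) (v t)))];
  exact: integrableD_itv.
Qed.

Lemma cintgM a b u v : ccont a b u -> cintg a b v -> cintg a b (fun t => u t * v t).
Proof.
move=> [? ?] [? ?]; split.
  rewrite (funext (fun t => cReM (u t) (v t))).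
  by apply: integrableB_itv; exact: integrableM_continuous.
rewrite (funext (fun t => cImM (u t) (v t))).
by apply: integrableD_itv; exact: integrableM_continuous.
Qed.

Lemma cintgMr a b u v : ccont a b u -> cintg a b v -> cintg a b (fun t => v t * u t).
Proof.
move=> cu iv; rewrite (_ : (fun _ => _) = (fun t => u t * v t)); first exact: cintgM.
by apply/funext => t; rewrite mulrC.
Qed.

Lemma cintegralD a b u v : cintg a b u -> cintg a b v ->
  cintegral `[a, b] (fun t => u t + v t) = cintegral `[a, b] u + cintegral `[a, b] v.
Proof.
move=> [? ?] [? ?]; apply: complex_eq; rewrite ?ReIm /=.
  by under eq_Rintegral do rewrite cReD; exact: RintegralD.
by under eq_Rintegral do rewrite cImD; exact: RintegralD.
Qed.

Lemma cintegralZ a b u z : cintg a b u ->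
  cintegral `[a, b] (fun t => z * u t) = z * cintegral `[a, b] u.
Proof.
move=> [? ?]; apply: complex_eq; rewrite ?ReIm /=.
  under eq_Rintegral do rewrite cReM.
  by rewrite RintegralB ?RintegralZl//; exact: integrableZ_itv.
under eq_Rintegral do rewrite cImM.
by rewrite RintegralD ?RintegralZl//; exact: integrableZ_itv.
Qed.

Lemma eq_cintegral (D : set R) u v : {in D, u =1 v} -> cintegral D u = cintegral D v.
Proof.
by move=> uv; congr Complex; apply: eq_Rintegral => t tD; rewrite uv.
Qed.

Lemma cC1_FTC a b F G : a <= b -> cC1 a b F G -> cintegral `[a, b] G = F b - F a.
Proof.
by move=> ab [F1 F2]; apply: complex_eq; rewrite ?ReIm /= (C1_FTC ab F1, C1_FTC ab F2).
Qed.

Lemma cC1_primitive a b G : a <= b -> ccont a b G ->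
  cC1 a b (fun x => cintegral `[a, x] G) G.
Proof. by move=> ab [G1 G2]; split => /=; exact: C1_primitive. Qed.

Lemma cC1_ccont a b F G : cC1 a b F G -> ccont a b F.
Proof. by case=> -[? _ _] [? _ _]. Qed.

Lemma cC1_deriv_ccont a b F G : cC1 a b F G -> ccont a b G.
Proof. by case=> -[_ ? _] [_ ? _]. Qed.

Lemma cC1_subitv a b c d F G : a <= c -> d <= b -> cC1 a b F G -> cC1 c d F G.
Proof. by move=> ac db [? ?]; split; exact: (C1_subitv ac db). Qed.

Lemma cC1_eq_deriv a b F G G' : {in `[a, b], G =1 G'} -> cC1 a b F G -> cC1 a b F G'.
Proof.
move=> GG [[c1 d1 e1] [c2 d2 e2]]; split; split => //.
- by apply: subspace_eq_continuous d1 => t; rewrite mem_setE => tab; rewrite /from_subspace GG.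
- by move=> x xab; rewrite -GG; [exact: e1|exact: subset_itv_oo_cc xab].
- by apply: subspace_eq_continuous d2 => t; rewrite mem_setE => tab; rewrite /from_subspace GG.
- by move=> x xab; rewrite -GG; [exact: e2|exact: subset_itv_oo_cc xab].
Qed.

Lemma cC1M a b F1 G1 F2 G2 : cC1 a b F1 G1 -> cC1 a b F2 G2 ->
  cC1 a b (fun t => F1 t * F2 t) (fun t => F1 t * G2 t + G1 t * F2 t).
Proof.
move=> C1F C2F.
have cF := ccontM (cC1_ccont C1F) (cC1_ccont C2F).
have [cG1 cG2] := ccontD
  (ccontM (cC1_ccont C1F) (cC1_deriv_ccont C2F))
  (ccontM (cC1_deriv_ccont C1F) (cC1_ccont C2F)).
have [[_ _ d1] [_ _ d2]] := C1F; have [[_ _ d3] [_ _ d4]] := C2F.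
case: cF => cF1 cF2.
split; split => // x xab; have ? := d1 x xab; have ? := d2 x xab;
  have ? := d3 x xab; have ? := d4 x xab.
- rewrite (funext (fun t => cReM (F1 t) (F2 t))).
  apply: is_derive_eq; rewrite !ReIm /GRing.scale /=; ring.
- rewrite (funext (fun t => cImM (F1 t) (F2 t))).
  apply: is_derive_eq; rewrite !ReIm /GRing.scale /=; ring.
Qed.

(** The real and imaginary parts of [1 / F] are quotients by the real function
    [|F|^2], to which the real rules apply. *)
Lemma cC1V a b F G : (forall t, t \in `[a, b] -> F t != 0) -> cC1 a b F G ->
  cC1 a b (fun t => (F t)^-1) (fun t => - (G t * (F t)^-1 * (F t)^-1)).
Proof.
move=> F0 CF.
have cV := ccontV F0 (cC1_ccont CF).
have [cG1 cG2] : ccont a b (fun t => - (G t * (F t)^-1 * (F t)^-1)).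
  have := ccontM (ccontM (ccontM (ccont_cst a b (-1)) (cC1_deriv_ccont CF)) cV) cV.
  rewrite (_ : (fun _ => _) = (fun t => - (G t * (F t)^-1 * (F t)^-1)))//.
  by apply/funext => t; rewrite /cst mulN1r !mulNr.
have [[_ _ d1] [_ _ d2]] := CF; case: cV => cV1 cV2.
split; split => // x xab; have i1 := d1 x xab; have i2 := d2 x xab;
 have Fx0 := sum_sqr_neq0 (F0 x (subset_itv_oo_cc xab)).
- rewrite (funext (fun t => cReV (F t))).
  have i3 : is_derive x 1 (fun t => Re (F t) ^+ 2 + Im (F t) ^+ 2)
     (2 * Re (F x) * Re (G x) + 2 * Im (F x) * Im (G x)).
    by apply: is_derive_eq; rewrite /GRing.scale /=; ring.
  have i4 := is_deriveV (f := (fun t => Re (F t) ^+ 2 + Im (F t) ^+ 2)) Fx0.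
  apply: is_derive_eq; rewrite !ReIm cReV cImV /GRing.scale /=; field.
  exact: Fx0.
- rewrite (funext (fun t => cImV (F t))).
  have i3 : is_derive x 1 (fun t => Re (F t) ^+ 2 + Im (F t) ^+ 2)
     (2 * Re (F x) * Re (G x) + 2 * Im (F x) * Im (G x)).
    by apply: is_derive_eq; rewrite /GRing.scale /=; ring.
  have i4 := is_deriveV (f := (fun t => Re (F t) ^+ 2 + Im (F t) ^+ 2)) Fx0.
  apply: is_derive_eq; rewrite !ReIm cReV cImV /GRing.scale /=; field.
  exact: Fx0.
Qed.

End ComplexCalculus.

(** * The Wronskian between two nodes *)

Section Wronskian.
Variable R : realType.
Notation mu := (@lebesgue_measure R).
Notation intg a b u := (mu.-integrable `[a, b] (EFin \o u)).
Implicit Types (a b x : R).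

Lemma primitiveM_integral a b v F G (c : R) : a <= b ->
  intg a b v -> C1 a b F G ->
  let E t := c + \int[mu]_(s in `[a, t]) v s in
  intg a b (fun t => E t * G t + v t * F t) /\
  \int[mu]_(t in `[a, b]) (E t * G t + v t * F t) = E b * F b - c * F a.
Proof.
move=> ab iv FG E; have [cF cG _] := FG.
have cV := parameterized_integral_continuous ab iv.
have cE : {within `[a, b], continuous E}.
  by move=> t; apply: cvgD; [exact: cvg_cst|exact: cV].
have iEG : intg a b (fun t => E t * G t).
  by apply: integrableM_continuous => //; exact: continuous_integrable_itv.
have ivF : intg a b (fun t => v t * F t).
  exact: integrableMr_continuous.
split; first exact: integrableD_itv.
rewrite RintegralD//.
have -> : \int[mu]_(t in `[a, b]) (E t * G t) =
  \int[mu]_(t in `[a, b]) (c * G t + (\int[mu]_(s in `[a, t]) v s) * G t).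
  by apply: eq_Rintegral => t _; rewrite mulrDl.
rewrite RintegralD//; last 2 first.
- exact/integrableZ_itv/continuous_integrable_itv.
- by apply: integrableM_continuous => //; exact: continuous_integrable_itv.
rewrite RintegralZl//; last exact: continuous_integrable_itv.
rewrite (C1_FTC ab FG) (product_rule_itv ab iv FG) /E; ring.
Qed.

(** The complex product is a combination of four real ones. *)
Lemma cprimitiveM_integral a b (v F G : R -> R[i]) (c : R[i]) : a <= b ->
  cintg a b v -> cC1 a b F G ->
  let E t := c + cintegral `[a, t] v in
  cintg a b (fun t => E t * G t + v t * F t) /\
  cintegral `[a, b] (fun t => E t * G t + v t * F t) = E b * F b - c * F a.
Proof.
move=> ab [iv1 iv2] [FG1 FG2] E.
have [i11 e11] := primitiveM_integral (Re c) ab iv1 FG1.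
have [i12 e12] := primitiveM_integral (Re c) ab iv1 FG2.
have [i21 e21] := primitiveM_integral (Im c) ab iv2 FG1.
have [i22 e22] := primitiveM_integral (Im c) ab iv2 FG2.
have ReE : (fun t => Re (E t * G t + v t * F t)) =
  (fun t => ((Re c + \int[mu]_(s in `[a, t]) Re (v s)) * Re (G t) + Re (v t) * Re (F t)) -
  ((Im c + \int[mu]_(s in `[a, t]) Im (v s)) * Im (G t) + Im (v t) * Im (F t))).
  by apply/funext => t; rewrite /E !ReIm /=; ring.
have ImE : (fun t => Im (E t * G t + v t * F t)) =
  (fun t => ((Re c + \int[mu]_(s in `[a, t]) Re (v s)) * Im (G t) + Re (v t) * Im (F t)) +
  ((Im c + \int[mu]_(s in `[a, t]) Im (v s)) * Re (G t) + Im (v t) * Re (F t))).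
  by apply/funext => t; rewrite /E !ReIm /=; ring.
split.
  by split; rewrite ?ReE ?ImE; [exact: integrableB_itv|exact: integrableD_itv].
apply: complex_eq; rewrite /cintegral.
  by rewrite [LHS]/= ReE RintegralB// e11 e22 /E !ReIm /=; ring.
by rewrite [LHS]/= ImE RintegralD// e12 e21 /E !ReIm /=; ring.
Qed.

Lemma ae_eq_cintegral a b (u v : R -> R[i]) : cintg a b u -> cintg a b v ->
  {ae mu, forall t : R, a < t < b -> u t = v t} ->
  cintegral `[a, b] u = cintegral `[a, b] v.
Proof.
move=> [iu1 iu2] [iv1 iv2] uv.
have key (p : R[i] -> R) : intg a b (fun t => p (u t)) -> intg a b (fun t => p (v t)) ->
    \int[mu]_(t in `[a, b]) p (u t) = \int[mu]_(t in `[a, b]) p (v t).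
  move=> iu iv; have oc (f : R -> R) : intg a b f ->
      \int[mu]_(t in `[a, b]) f t = \int[mu]_(t in `]a, b[) f t.
    move=> jf; rewrite Rintegral_itv_obnd_cbnd ?Rintegral_itv_bndo_bndc//.
      by apply: integrableS jf => //; apply: subset_itv; rewrite bnd_simp.
    by apply: integrableS jf => //; apply: subset_itv; rewrite bnd_simp.
  rewrite oc// [RHS]oc//; congr fine; apply: ae_eq_integral => //.
  - apply: (measurable_int mu); apply: integrableS iu => //; apply: subset_itv; by rewrite bnd_simp.
  - apply: (measurable_int mu); apply: integrableS iv => //; apply: subset_itv; by rewrite bnd_simp.
  - by move: uv; apply: (@filterS _ _ (ae_filter_ringOfSetsType _)) => t tuv /=;
      rewrite in_itv /= => /tuv ->.
by apply: complex_eq => /=; exact: key.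
Qed.

(** In the difference of the product rules for [k * f] and [g * e] the terms
    [g * k] cancel, which leaves the integral of [w * f - v * e]. *)
Lemma wronskian_integral a b (f g v e k w : R -> R[i]) (lam : R[i]) :
  a <= b -> cintg a b v -> cintg a b w -> cC1 a b f g -> cC1 a b e k ->
  (forall x, x \in `[a, b] -> g x = g a + cintegral `[a, x] v) ->
  (forall x, x \in `[a, b] -> k x = k a + cintegral `[a, x] w) ->
  {ae mu, forall t : R, a < t < b -> w t * f t - v t * e t = lam * (f t * e t)} ->
  forall x, x \in `[a, b] -> f x * k x - g x * e x =
   f a * k a - g a * e a + lam * cintegral `[a, x] (fun t => f t * e t).
Proof.
move=> ab iv iw fg ek gv kw vw x xab.
have [ax xb] : a <= x /\ x <= b by move: xab; rewrite in_itv /= => /andP[].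
have iv' := cintg_subitv (lexx a) xb iv; have iw' := cintg_subitv (lexx a) xb iw.
have fg' := cC1_subitv (lexx a) xb fg; have ek' := cC1_subitv (lexx a) xb ek.
have [i1 e1] := cprimitiveM_integral (k a) ax iw' fg'.
have [i2 e2] := cprimitiveM_integral (g a) ax iv' ek'.
have aab : a \in `[a, b] by rewrite in_itv /= lexx.
have ife : cintg a x (fun t => f t * e t).
  exact/ccont_intg/ccontM/(cC1_ccont ek')/(cC1_ccont fg').
have E : cintegral `[a, x] (fun t => (k a + cintegral `[a, t] w) * g t + w t * f t) =
  cintegral `[a, x] (fun t => ((g a + cintegral `[a, t] v) * k t + v t * e t) + lam * (f t * e t)).
  apply: ae_eq_cintegral => //.
    by apply: cintgD => //; apply: cintgM => //; exact: ccont_cst.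
  move: vw; apply: (@filterS _ _ (ae_filter_ringOfSetsType _)) => t tvw /andP[a_t tx].
  have tab : t \in `[a, b] by rewrite in_itv /= (ltW a_t) (le_trans (ltW tx)).
  rewrite -gv// -kw// -tvw ?a_t ?(lt_le_trans tx)//; ring.
move: E; rewrite e1 cintegralD//; last by apply: cintgM => //; exact: ccont_cst.
rewrite cintegralZ// e2 -gv// -kw// => E.
apply/eqP; rewrite -subr_eq0; apply/eqP.
have {}E : k x * f x - k a * f a - (g x * e x - g a * e a +
    lam * cintegral `[a, x] (fun t => f t * e t)) = 0.
  by rewrite E subrr.
rewrite -[RHS]E; ring.
Qed.

(** On a bounded interval [|z| <= |z|^2 + 1] reduces integrability to that of
    the square and of a constant. *)
Lemma in_L2_cintg a b (u : R -> R[i]) : in_L2 a b u -> cintg a b u.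
Proof.
move=> [m1 m2 i2].
have normE z : Normc.normc z ^+ 2 = Re z ^+ 2 + Im z ^+ 2 :> R.
  by case: z => x y; rewrite /= sqr_sqrtr// addr_ge0// sqr_ge0.
have key (p : R[i] -> R) : (forall z, `|p z| <= Normc.normc z ^+ 2 + 1) ->
    measurable_fun `]a, b[ (fun t => p (u t)) -> intg a b (fun t => p (u t)).
  move=> ple mp.
  have ip : mu.-integrable `]a, b[ (EFin \o (fun t => p (u t))).
    apply: (@le_integrable _ _ _ mu _ _ _ (EFin \o (fun t => Normc.normc (u t) ^+ 2 + 1))) => //.
    - exact/measurable_EFinP.
    - move=> t _; rewrite /= lee_fin (le_trans (ple _))// ger0_norm//.
      by rewrite addr_ge0// sqr_ge0.
    - rewrite (_ : _ \o _ = (EFin \o (fun t => (Normc.normc (u t) ^+ 2)%R)) \+ cst 1)%E//.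
      apply: integrableD => //.
      have i1 : intg a b (cst (1 : R)).
        by apply: continuous_integrable_itv => t; exact: cvg_cst.
      by apply: integrableS i1 => //; apply: subset_itv; rewrite bnd_simp.
  have mpc : measurable_fun `[a, b] (fun t => p (u t)).
    exact/measurable_fun_itv_bndo_bndcP/measurable_fun_itv_obnd_cbndP.
  case/integrableP: ip => mo lo; apply/integrableP; split.
    exact/measurable_EFinP.
  rewrite -integral_itv_obnd_cbnd; last first.
    apply: measurableT_comp => //; apply/measurable_EFinP.
    by apply: measurable_funS mpc => //; apply: subset_itv; rewrite bnd_simp.
  rewrite -integral_itv_bndo_bndc//.
  by apply: measurableT_comp.
split; apply: key => // z; rewrite normE.
- rewrite -[X in `|X|]addr0 -subr_ge0; have := sqr_ge0 (Im z).
  rewrite addr0; have := sqr_ge0 (`|Re z| - 1); rewrite -[Re z ^+ 2]real_normK ?num_real//.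
  nra.
- have := sqr_ge0 (Re z); have := sqr_ge0 (`|Im z| - 1).
  rewrite -[Im z ^+ 2]real_normK ?num_real//; nra.
Qed.

End Wronskian.

(** * Regularity and jumps of the solutions *)

Section Solutions.
Variable R : realType.
Notation mu := (@lebesgue_measure R).
Notation intg a b u := (mu.-integrable `[a, b] (EFin \o u)).
Implicit Types (a b x : R).

Lemma C1_deriv_right_limit a b (F G : R -> R) l : a < b -> C1 a b F G ->
  derive1 F y @[y --> a^'+] --> l -> l = G a.
Proof.
move=> ab [_ cG dF] Fl; have [_ Ga _] := (continuous_within_itvP _ ab).1 cG.
apply: (cvg_unique _ Fl) => //; apply: cvg_trans Ga; apply: near_eq_cvg.
near=> y; have yab : y \in `]a, b[.
  rewrite in_itv /=; apply/andP; split; near: y; [exact: nbhs_right_gt|exact: nbhs_right_lt].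
by have ? := dF y yab; rewrite derive1E; apply/esym; exact: derive_val.
Unshelve. all: by end_near. Qed.

Lemma C1_deriv_left_limit a b (F G : R -> R) l : a < b -> C1 a b F G ->
  derive1 F y @[y --> b^'-] --> l -> l = G b.
Proof.
move=> ab [_ cG dF] Fl; have [_ _ Gb] := (continuous_within_itvP _ ab).1 cG.
apply: (cvg_unique _ Fl) => //; apply: cvg_trans Gb; apply: near_eq_cvg.
near=> y; have yab : y \in `]a, b[.
  rewrite in_itv /=; apply/andP; split; near: y; [exact: nbhs_left_gt|exact: nbhs_left_lt].
by have ? := dF y yab; rewrite derive1E; apply/esym; exact: derive_val.
Unshelve. all: by end_near. Qed.

(** By the mean value theorem the difference quotient is a value of [G] between
    [a] and [y]. *)
Lemma C1_right_derivative a b (F G : R -> R) l : a < b -> C1 a b F G ->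
  (F y - F a) / (y - a) @[y --> a^'+] --> l -> l = G a.
Proof.
move=> ab [cF cG dF] Fl; have [_ Ga _] := (continuous_within_itvP _ ab).1 cG.
apply: (cvg_unique _ Fl) => //; apply/cvgrPdist_lt => e e0.
have /cvgrPdist_lt /(_ e e0) [d /= d0 Hd] := Ga.
near=> y.
have ay : a < y by near: y; exact: nbhs_right_gt.
have yb : y < b by near: y; exact: nbhs_right_lt.
have yd : y < a + d by near: y; apply: nbhs_right_lt; rewrite ltrDl.
have [c||c cay ->] := MVT ay (f := F) (df := G).
- by rewrite in_itv /= => /andP[ac cy]; apply: dF; rewrite in_itv /= ac (lt_trans cy).
- by apply: within_itvS cF => //; exact: ltW.
rewrite mulfK ?subr_eq0 ?gt_eqF//.
move: cay; rewrite in_itv /= => /andP[ac cy].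
by apply: Hd => //; rewrite /= ltr0_norm ?subr_lt0// opprB ltrBlDl (lt_trans cy).
Unshelve. all: by end_near. Qed.

(** Absolute continuity is applied to a single interval. *)
Lemma abs_continuous_ccont a b (u : R -> R[i]) : abs_continuous a b u -> ccont a b u.
Proof.
move=> ac.
have key (p : R[i] -> R) : (forall z w, `|p z - p w| <= Normc.normc (z - w)) ->
    {within `[a, b], continuous (fun t => p (u t))}.
  move=> pN; apply/subspace_continuousP => x /=; rewrite in_itv /= => /andP[ax xb].
  apply/cvgrPdist_lt => e e0; have [d d0 H] := ac e e0.
  rewrite near_withinE; apply: filterS (nbhsx_ballx x d d0) => t.
  rewrite -ball_normE /= => xt; rewrite in_itv /= => /andP[a_t tb].
  have key2 (l r : R) : a <= l -> l <= r -> r <= b -> r - l < d -> Normc.normc (u r - u l) < e.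
    move=> al lr rb rl; have := H 1%N (fun=> l) (fun=> r).
    rewrite !big_ord1; apply => //; first by move=> _; rewrite al lr.
    by move=> i j; rewrite !ord1 eqxx.
  apply: le_lt_trans (pN _ _) _.
  have [xt'|tx] := leP x t.
    rewrite -normcN opprB; apply: key2 => //.
    by move: xt; rewrite distrC ger0_norm ?subr_ge0.
  apply: key2 => //; first exact: ltW.
  by move: xt; rewrite ger0_norm ?subr_ge0// ltW.
split; apply: key => z w.
- rewrite -cReB; case: (z - w) => r s /=.
  by rewrite -sqrtr_sqr ler_wsqrtr// lerDl sqr_ge0.
- rewrite -cImB; case: (z - w) => r s /=.
  by rewrite -sqrtr_sqr ler_wsqrtr// lerDr sqr_ge0.
Qed.

Lemma Rintegral_oo_cc a b (u : R -> R) : intg a b u ->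
  \int[mu]_(t in `]a, b[) u t = \int[mu]_(t in `[a, b]) u t.
Proof.
move=> iu; rewrite -[RHS]Rintegral_itv_obnd_cbnd -?Rintegral_itv_bndo_bndc//;
  by apply: integrableS iu => //; apply: subset_itv; rewrite bnd_simp.
Qed.

Lemma is_weak_derivative_Re_Im a b (u v : R -> R[i]) : cintg a b u -> cintg a b v ->
  is_weak_derivative a b u v ->
  weak_derivative_on a b (fun t => Re (u t)) (fun t => Re (v t)) /\
  weak_derivative_on a b (fun t => Im (u t)) (fun t => Im (v t)).
Proof.
move=> [iu1 iu2] [iv1 iv2] uv.
split=> phi phiC; have [[cphi cdphi _] _ _] := test_function_C1 phiC.
- rewrite -Rintegral_oo_cc; last exact: integrableMr_continuous.
  rewrite -[in RHS]Rintegral_oo_cc; last exact: integrableMr_continuous.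
  have := congr1 (@complex.Re R) (uv phi phiC); rewrite cReN /cintegral /= => E.
  transitivity (\int[mu]_(t in `]a, b[) Re (u t * (derive1 phi t)%:C)).
    by apply: eq_Rintegral => t _; rewrite cReM /= mulr0 subr0.
  by rewrite E; congr (- _); apply: eq_Rintegral => t _; rewrite cReM /= mulr0 subr0.
- rewrite -Rintegral_oo_cc; last exact: integrableMr_continuous.
  rewrite -[in RHS]Rintegral_oo_cc; last exact: integrableMr_continuous.
  have := congr1 (@complex.Im R) (uv phi phiC); rewrite cImN /cintegral /= => E.
  transitivity (\int[mu]_(t in `]a, b[) Im (u t * (derive1 phi t)%:C)).
    by apply: eq_Rintegral => t _; rewrite cImM /= mulr0 add0r.
  by rewrite E; congr (- _); apply: eq_Rintegral => t _; rewrite cImM /= mulr0 add0r.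
Qed.

Lemma is_weak_derivative2_cC1 a b (u v : R -> R[i]) : a < b -> ccont a b u ->
  in_L2 a b v -> is_weak_derivative2 a b u v ->
  exists2 g, cC1 a b u g &
    forall x, x \in `[a, b] -> g x = g a + cintegral `[a, x] v.
Proof.
move=> ab cu /in_L2_cintg iv [w [/in_L2_cintg iw uw wv]].
have [cu1 cu2] := cu; have iu := ccont_intg cu.
have [w1 w2] := is_weak_derivative_Re_Im iu iw uw.
have [w3 w4] := is_weak_derivative_Re_Im iw iv wv.
have [iv1 iv2] := iv; have [iw1 iw2] := iw.
have [c1 C1u] := weak_derivative2_C1 ab cu1 iw1 iv1 w1 w3.
have [c2 C2u] := weak_derivative2_C1 ab cu2 iw2 iv2 w2 w4.
exists (fun x => (c1 +i* c2) + cintegral `[a, x] v).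
  by split.
move=> x _; rewrite set_itv1 -[RHS]addrA; congr (_ + _).
by rewrite {2}/cintegral !Rintegral_set1 add0r.
Qed.

Lemma interactions_node_le b N xs (alpha : nat -> R[i]) : interactions b N xs alpha ->
  forall k, (k <= N.+1)%N -> 0 <= xs k <= b.
Proof.
move=> [x0 xN xlt _].
have mono j k : (j <= k <= N.+1)%N -> xs j <= xs k.
  elim: k => [|k IH]; first by rewrite leqn0 => /andP[/eqP ->].
  rewrite leq_eqVlt => /andP[/predU1P[->//|jk] kN].
  by apply: le_trans (IH _) (ltW (xlt k _)); rewrite // -ltnS jk ltnW.
by move=> k kN; rewrite -x0 -xN !mono// ?leq0n// kN leqnn.
Qed.

(** On the [k]-th interval [g k] is the continuous representative of [u'] and
    [v k] the weak second derivative. The prescribed jumps of [u'] become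
    relations between consecutive [g k], because one-sided limits of the
    derivative are values of the continuous representatives. *)
Lemma solution_pieces (q : R -> R[i]) b N xs alpha lam u :
  interactions b N xs alpha -> is_solution q b N xs alpha lam u ->
  ccont 0 b u /\
  exists g v : nat -> R -> R[i],
  [/\ forall k, (k <= N)%N ->
       [/\ cC1 (xs k) (xs k.+1) u (g k), cintg (xs k) (xs k.+1) (v k),
         forall x, x \in `[xs k, xs k.+1] ->
           g k x = g k (xs k) + cintegral `[xs k, x] (v k) &
         {ae mu, forall t : R, xs k < t < xs k.+1 ->
           - v k t + q t * u t = lam * u t}],
      forall k, (k < N)%N -> g k.+1 (xs k.+1) = g k (xs k.+1) + alpha k.+1 * u (xs k.+1) &
      forall l, is_right_derivative u 0 l -> g 0%N 0 = l].
Proof.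
move=> hI [[acu _ jumps] eqn].
have cu := abs_continuous_ccont acu; split => //.
have xle := interactions_node_le hI.
have [x0 xN xlt _] := hI.
have /choice [p Hp] : forall k, exists p : (R -> R[i]) * (R -> R[i]), (k <= N)%N ->
   [/\ cC1 (xs k) (xs k.+1) u p.1, cintg (xs k) (xs k.+1) p.2,
         forall x, x \in `[xs k, xs k.+1] ->
           p.1 x = p.1 (xs k) + cintegral `[xs k, x] p.2 &
         {ae mu, forall t : R, xs k < t < xs k.+1 ->
           - p.2 t + q t * u t = lam * u t}].
  move=> k; have [kN|kN] := leqP k N; last by exists (u, u).
  have [v [vL2 uv aev]] := eqn k kN.
  have /andP[k0 _] := xle k (leqW kN); have /andP[_ kb] := xle k.+1 kN.
  have [g ug gv] := is_weak_derivative2_cC1 (xlt k kN) (ccont_subitv k0 kb cu) vL2 uv.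
  by exists (g, v) => _; split => //; exact: in_L2_cintg.
exists (fun k => (p k).1), (fun k => (p k).2); split => //.
- move=> k kN.
  have [[c1 c2] _ _ _] := Hp k (ltnW kN); have [[d1 d2] _ _ _] := Hp k.+1 kN.
  have [dl [dr [[_ l1 l2] [_ r1 r2] /eqP]]] := jumps k.+1 kN.
  have xk := xlt k (ltnW kN); have xk1 := xlt k.+1 kN.
  rewrite subr_eq => /eqP; rewrite addrC => E.
  have -> : (p k.+1).1 (xs k.+1) = dr.
    by apply: complex_eq; rewrite -?(C1_deriv_right_limit xk1 d1 r1) -?(C1_deriv_right_limit xk1 d2 r2).
  rewrite E; congr (_ + _).
  by apply: complex_eq; rewrite -?(C1_deriv_left_limit xk c1 l1) -?(C1_deriv_left_limit xk c2 l2).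
- move=> l [l1 l2]; have [[]] := Hp 0%N (leq0n _).
  have := xlt 0%N (leq0n _); rewrite x0 => x1 c1 c2 _ _ _.
  by apply: complex_eq; rewrite -?(C1_right_derivative x1 c1 l1) -?(C1_right_derivative x1 c2 l2).
Qed.

End Solutions.

(** * The integral equation for the quotient of two solutions *)

Section Quotient.
Variable R : realType.
Notation mu := (@lebesgue_measure R).
Implicit Types (a b x : R).

Lemma cintegral_point a (u : R -> R[i]) : cintegral `[a, a] u = 0.
Proof. by rewrite set_itv1 /cintegral !Rintegral_set1. Qed.

Lemma cintegral_split a c x b (u : R -> R[i]) : a <= c -> c <= x -> x <= b -> ccont a b u ->
  cintegral `[a, x] u = cintegral `[a, c] u + cintegral `[c, x] u.
Proof.
move=> ac cx xb cu; have ab := le_trans (le_trans ac cx) xb.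
have /(cC1_subitv ac xb) /(cC1_FTC cx) -> := cC1_primitive ab cu.
by rewrite addrC subrK.
Qed.

(** The Wronskian of [f] and [e] crosses each node unchanged, so the formula
    obtained between two nodes holds on [[0, b]] with one and the same constant
    of integration. Dividing by [f^2] gives the derivative of [e / f]. *)
Lemma solution_quotient (q : R -> R[i]) b N xs alpha lam f e h kappa :
  interactions b N xs alpha ->
  is_solution q b N xs alpha 0 f -> is_solution q b N xs alpha lam e ->
  (forall x, 0 <= x <= b -> f x != 0) -> f 0 = 1 -> e 0 = 1 ->
  is_right_derivative f 0 h -> is_right_derivative e 0 kappa ->
  forall x, 0 <= x <= b ->
  e x = f x * (1 + cintegral `[0, x] (fun s => (f s ^+ 2)^-1 *
    (kappa - h - lam * cintegral `[0, s] (fun t => f t * e t)))).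
Proof.
move=> hI sf se f0 f01 e01 fh ek.
have [cf [gf [v [pf jf df]]]] := solution_pieces hI sf.
have [ce [ge [w [pe je de]]]] := solution_pieces hI se.
have xle := interactions_node_le hI; have [x0 xN xlt _] := hI.
have b0 : 0 <= b by have /andP[] := xle N.+1 (leqnn _); rewrite xN.
pose I s := cintegral `[0, s] (fun t => f t * e t).
have I1 : cC1 0 b I (fun t => f t * e t) by exact/cC1_primitive/ccontM.
pose P s := (f s ^+ 2)^-1 * (kappa - h - lam * I s).
have f0' t : t \in `[0, b] -> f t != 0 by rewrite in_itv; exact: f0.
have cP : ccont 0 b P.
  apply: ccontM.
    exact: ccont_sqrV.
  rewrite (_ : (fun _ => _) = (fun t => (kappa - h) + (- lam) * I t)).
    by apply: ccontD; [exact: ccont_cst|apply: ccontM; [exact: ccont_cst|exact: cC1_ccont I1]].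
  by apply/funext => t; rewrite mulNr.
have JP := cC1_primitive b0 cP.
(* From the left end of the k-th interval to the rest of it. *)
have W k : (k <= N)%N -> f (xs k) * ge k (xs k) - gf k (xs k) * e (xs k) =
      kappa - h - lam * I (xs k) ->
    forall x, x \in `[xs k, xs k.+1] ->
      f x * ge k x - gf k x * e x = kappa - h - lam * I x.
  move=> kN Wk x xk.
  have [ufk ivk gvk aek] := pf k kN; have [uek iwk gwk aewk] := pe k kN.
  have /andP[xk0 _] := xle k (leqW kN); have /andP[_ xkb] := xle k.+1 kN.
  have [xkx xxk] : xs k <= x /\ x <= xs k.+1 by move: xk; rewrite in_itv /= => /andP[].
  have aevw : {ae mu, forall t : R, xs k < t < xs k.+1 ->
      w k t * f t - v k t * e t = - lam * (f t * e t)}.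
    move: aek aewk; apply: (@filterS2 _ _ (ae_filter_ringOfSetsType _)) => t t1 t2 tk.
    have {}t1 : v k t = q t * f t.
      by have := t1 tk; rewrite mul0r addrC => /eqP; rewrite subr_eq0 => /eqP.
    have {}t2 : w k t = q t * e t - lam * e t by rewrite -(t2 tk); ring.
    by rewrite t1 t2; ring.
  rewrite (wronskian_integral (ltW (xlt k kN)) ivk iwk ufk uek gvk gwk aevw xk) Wk.
  rewrite /I (cintegral_split xk0 xkx (le_trans xxk xkb) (ccontM cf ce)); ring.
(* At a node both jumps are alpha times the value, and they cancel. *)
have S k : (k <= N)%N -> f (xs k) * ge k (xs k) - gf k (xs k) * e (xs k) =
      kappa - h - lam * I (xs k).
  elim: k => [|k IH] kN.
    by rewrite x0 (df _ fh) (de _ ek) f01 e01 /I cintegral_point; ring.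
  have xk1 : xs k.+1 \in `[xs k, xs k.+1] by rewrite in_itv /= lexx ltW ?xlt// ltnW.
  rewrite -(W k (ltnW kN) (IH (ltnW kN)) _ xk1) jf// je//; ring.
have Q k : (k <= N.+1)%N -> forall x, 0 <= x <= xs k -> e x / f x = 1 + cintegral `[0, x] P.
  elim: k => [|k IH] kN x.
    rewrite x0 => /andP[x_ge0 x_le0]; have -> : x = 0 by apply/eqP; rewrite eq_le x_ge0 x_le0.
    by rewrite f01 e01 divr1 cintegral_point addr0.
  move=> /andP[x_ge0 xk1]; have [xk|xk] := leP x (xs k).
    by apply: IH; rewrite ?x_ge0// ltnW.
  have [ufk _ _ _] := pf k kN; have [uek _ _ _] := pe k kN.
  have /andP[xk0 _] := xle k (ltnW kN); have /andP[_ xkb] := xle k.+1 kN.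
  have f0k t : t \in `[xs k, x] -> f t != 0.
    rewrite in_itv /= => /andP[t1 t2]; apply: f0.
    by rewrite (le_trans xk0 t1) (le_trans t2)// (le_trans xk1).
  have Y1 := cC1M (cC1_subitv (lexx _) xk1 uek) (cC1V f0k (cC1_subitv (lexx _) xk1 ufk)).
  have {}Y1 : cC1 (xs k) x (fun t => e t / f t) P.
    apply: cC1_eq_deriv Y1 => t txk; have ft0 := f0k t txk.
    have txk1 : t \in `[xs k, xs k.+1].
      by move: txk; rewrite !in_itv /= => /andP[-> /le_trans ->].
    rewrite /P -(W k kN (S k kN) t txk1); field; exact: ft0.
  have IHk : e (xs k) / f (xs k) = 1 + cintegral `[0, xs k] P.
    by apply: IH; rewrite ?xk0 ?lexx// ltnW.
  rewrite (cintegral_split xk0 (ltW xk) (le_trans xk1 xkb) cP) addrA -IHk.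
  by rewrite (cC1_FTC (ltW xk) Y1) addrC subrK.
move=> x x0b; rewrite -(Q N.+1)// ?xN//.
by rewrite mulrC divfK// f0.
Qed.

End Quotient.

(** * Formal powers *)

Section PowerSeries.
Variable R : realType.
Notation mu := (@lebesgue_measure R).
Implicit Types (a b x r : R) (z w : R[i]).

(** This norm is bounded through the real and imaginary parts separately, which
    is how integrals are defined. *)
Definition norm1 z : R := `|Re z| + `|Im z|.

Lemma norm1_ge0 z : 0 <= norm1 z. Proof. by rewrite addr_ge0. Qed.

Lemma norm1D z w : norm1 (z + w) <= norm1 z + norm1 w.
Proof. by rewrite /norm1 cReD cImD addrACA lerD// ler_normD. Qed.

Lemma norm1N z : norm1 (- z) = norm1 z.
Proof. by rewrite /norm1 cReN cImN !normrN. Qed.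

Lemma norm1M z w : norm1 (z * w) <= norm1 z * norm1 w.
Proof.
rewrite /norm1 cReM cImM mulrDl !mulrDr -!normrM.
apply: (le_trans (lerD (ler_normB _ _) (ler_normD _ _))).
rewrite le_eqVlt; apply/orP; left; apply/eqP; ring.
Qed.

Lemma norm1_real r : norm1 r%:C = `|r|.
Proof. by rewrite /norm1 /= normr0 addr0. Qed.

Lemma ccont_eq a b (u v : R -> R[i]) : {in `[a, b], u =1 v} -> ccont a b u -> ccont a b v.
Proof.
move=> uv [c1 c2]; split.
- by apply: subspace_eq_continuous c1 => t; rewrite mem_setE => tab; rewrite /from_subspace uv.
- by apply: subspace_eq_continuous c2 => t; rewrite mem_setE => tab; rewrite /from_subspace uv.
Qed.

Lemma ccontZ a b z (u : R -> R[i]) : ccont a b u -> ccont a b (fun t => z * u t).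
Proof. by move=> cu; apply: ccontM => //; exact: ccont_cst. Qed.

Lemma ccont_max a b (u : R -> R[i]) : a <= b -> ccont a b u ->
  exists2 c, c \in `[a, b] & forall t, t \in `[a, b] -> norm1 (u t) <= norm1 (u c).
Proof.
move=> ab [c1 c2].
have cn : {within `[a, b], continuous (fun t => norm1 (u t))}.
  by move=> t; apply: cvgD; apply: cvg_norm; [exact: c1|exact: c2].
by have [c cab H] := EVT_max ab cn; exists c.
Qed.

Lemma cintegral_bound a b (u : R -> R[i]) M : a <= b -> ccont a b u ->
  (forall t, t \in `[a, b] -> norm1 (u t) <= M) ->
  norm1 (cintegral `[a, b] u) <= 2 * (b - a) * M.
Proof.
move=> ab cu uM; have [i1 i2] := ccont_intg cu.
have bnd (p : R -> R) : mu.-integrable `[a, b] (EFin \o p) ->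
    (forall t, t \in `[a, b] -> `|p t| <= M) -> `|\int[mu]_(t in `[a, b]) p t| <= M * (b - a).
  move=> ip pM; apply: le_trans (le_normr_Rintegral _ ip) _ => //.
  have <- : \int[mu]_(t in `[a, b]) M = M * (b - a).
    rewrite Rintegral_cst//= lebesgue_measure_itv/= lte_fin.
    by move: ab; rewrite le_eqVlt => /predU1P[->|->]//; rewrite ltxx subrr.
  apply: le_Rintegral => //.
  - exact: integrable_norm.
  - by apply: continuous_integrable_itv => t; exact: cvg_cst.
apply: le_trans (lerD (bnd _ i1 _) (bnd _ i2 _)) _.
- by move=> t tab; apply: le_trans (uM t tab); rewrite lerDl.
- by move=> t tab; apply: le_trans (uM t tab); rewrite lerDr.
by rewrite le_eqVlt; apply/orP; left; apply/eqP; ring.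
Qed.

Section Spps.
Variables (b : R) (f : R -> R[i]).
Hypotheses (b0 : 0 <= b) (cf : ccont 0 b f) (f0 : forall t, t \in `[0, b] -> f t != 0).

(** The operator that raises the degree of a formal power by two, up to a
    constant factor; it solves [L y = - u] in terms of the nonvanishing
    solution [f] of [L f = 0]. *)
Definition sppsV (y : R -> R[i]) x :=
  f x * cintegral `[0, x] (fun s => (f s ^+ 2)^-1 * cintegral `[0, s] (fun t => f t * y t)).

Let cfm2 : ccont 0 b (fun s => (f s ^+ 2)^-1) := ccont_sqrV f0 cf.

Let cprim u : ccont 0 b u -> ccont 0 b (fun x => cintegral `[0, x] u).
Proof. by move=> cu; exact/cC1_ccont/(cC1_primitive b0 cu). Qed.

Lemma sppsV_ccont y : ccont 0 b y -> ccont 0 b (sppsV y).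
Proof. by move=> cy; exact/ccontM/cprim/ccontM/cprim/ccontM. Qed.

Lemma sppsV_linear y1 y2 z x : x \in `[0, b] -> ccont 0 b y1 -> ccont 0 b y2 ->
  sppsV (fun t => y1 t + z * y2 t) x = sppsV y1 x + z * sppsV y2 x.
Proof.
rewrite in_itv /= => /andP[x0 xb] c1 c2; rewrite /sppsV.
have cI y : ccont 0 b y -> ccont 0 b (fun s => cintegral `[0, s] (fun t => f t * y t)).
  by move=> cy; exact/cprim/ccontM.
have -> : cintegral `[0, x] (fun s => (f s ^+ 2)^-1 * cintegral `[0, s] (fun t => f t * (y1 t + z * y2 t))) =
  cintegral `[0, x] (fun s => (f s ^+ 2)^-1 * cintegral `[0, s] (fun t => f t * y1 t) +
    z * ((f s ^+ 2)^-1 * cintegral `[0, s] (fun t => f t * y2 t))).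
  apply: eq_cintegral => s; rewrite mem_setE in_itv /= => /andP[s0 sx].
  have sb := le_trans sx xb.
  have -> : cintegral `[0, s] (fun t => f t * (y1 t + z * y2 t)) =
     cintegral `[0, s] (fun t => f t * y1 t + z * (f t * y2 t)).
    by apply: eq_cintegral => t _; ring.
  have i1 := ccont_intg (ccont_subitv (lexx 0) sb (ccontM cf c1)).
  have i2 := ccont_intg (ccont_subitv (lexx 0) sb (ccontM cf c2)).
  rewrite cintegralD//; last by apply: cintgM => //; exact: ccont_cst.
  by rewrite cintegralZ// mulrDr [_ * (z * _)]mulrCA.
have i1 := ccont_intg (ccont_subitv (lexx 0) xb (ccontM cfm2 (cI _ c1))).
have i2 := ccont_intg (ccont_subitv (lexx 0) xb (ccontM cfm2 (cI _ c2))).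
rewrite cintegralD//; last by apply: cintgM => //; exact: ccont_cst.
by rewrite cintegralZ// mulrDr [_ * (z * _)]mulrCA.
Qed.

Lemma sppsV_bound : exists2 B : R, 0 <= B & forall y M, ccont 0 b y ->
  (forall t, t \in `[0, b] -> norm1 (y t) <= M) ->
  forall x, x \in `[0, b] -> norm1 (sppsV y x) <= B * M.
Proof.
have [cF _ HF] := ccont_max b0 cf; have [cG _ HG] := ccont_max b0 cfm2.
pose Mf := norm1 (f cF); pose Mg := norm1 ((f cG ^+ 2)^-1).
have Mf0 : 0 <= Mf by exact: norm1_ge0.
have Mg0 : 0 <= Mg by exact: norm1_ge0.
exists (Mf * (2 * b * (Mg * (2 * b * Mf)))).
  by rewrite !mulr_ge0.
move=> y M cy yM x; rewrite in_itv /= => /andP[x0 xb].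
have M0 : 0 <= M by apply: le_trans (norm1_ge0 (y 0)) (yM _ _); rewrite in_itv /= lexx.
have mulb (z w : R[i]) (A D : R) : norm1 z <= A -> norm1 w <= D -> norm1 (z * w) <= A * D.
  move=> zA wD; apply: le_trans (norm1M _ _) _.
  by apply: ler_pM; rewrite ?norm1_ge0.
have intb s (u : R -> R[i]) D : 0 <= s -> s <= b -> ccont 0 b u ->
    (forall t, t \in `[0, s] -> norm1 (u t) <= D) -> norm1 (cintegral `[0, s] u) <= 2 * b * D.
  move=> s0 sb cu uD; apply: le_trans (cintegral_bound s0 (ccont_subitv (lexx 0) sb cu) uD) _.
  rewrite subr0 ler_wpM2r// ?ler_pM2l//.
  by apply: le_trans (norm1_ge0 (u 0)) (uD _ _); rewrite in_itv /= lexx.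
have inb s t : s <= b -> t \in `[0, s] -> t \in `[0, b].
  by move=> sb; rewrite !in_itv /= => /andP[-> /le_trans ->].
have -> : Mf * (2 * b * (Mg * (2 * b * Mf))) * M =
  Mf * (2 * b * (Mg * (2 * b * (Mf * M)))) by ring.
have inner s : 0 <= s -> s <= b ->
    norm1 (cintegral `[0, s] (fun t => f t * y t)) <= 2 * b * (Mf * M).
  move=> s0 sb; apply: intb => //; first exact: ccontM.
  move=> t ts; have tb : t \in `[0, b] by exact: inb ts.
  by apply: mulb; [exact: HF|exact: yM].
apply: (mulb); first by apply: HF; rewrite in_itv /= x0.
apply: (intb) => //; first exact/ccontM/cprim/ccontM.
move=> s sx; have sb := inb _ _ xb sx; apply: mulb; first exact: HG.
by apply: inner; move: sb; rewrite in_itv /= => /andP[].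
Qed.

Lemma exprz_sign_even k z : ~~ odd k -> z ^ ((-1) ^+ k) = z.
Proof. by move=> /negbTE ok; rewrite -signr_odd ok expr0 expr1z. Qed.

Lemma exprz_sign_odd k z : odd k -> z ^ ((-1) ^+ k) = z^-1.
Proof. by move=> ok; rewrite -signr_odd ok expr1. Qed.

Lemma formal_power0 x : formal_power f 0 x = f x.
Proof. by rewrite /formal_power /= mulr1. Qed.

Lemma formal_power1 x : formal_power f 1 x = f x * cintegral `[0, x] (fun s => (f s ^+ 2)^-1).
Proof.
rewrite /formal_power /= mul1r; congr (_ * _).
by apply: eq_cintegral => s _; rewrite mul1r (@exprz_sign_odd 1).
Qed.

(** Two steps of either recursion multiply first by [f^2] and then by [f^-2]:
    the sequence used for [k] is the one for which the parities come out in
    this order. *)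
Lemma formal_powerSS k x : x \in `[0, b] -> ccont 0 b (formal_power f k) ->
  formal_power f k.+2 x = (k.+2%:R * k.+1%:R) * sppsV (formal_power f k) x.
Proof.
rewrite in_itv /= => /andP[x0 xb] ck.
have E : cintegral `[0, x] (fun s =>
       (k.+1%:R * cintegral `[0, s] (fun t => f t * formal_power f k t)) * (f s ^+ 2)^-1)
   = k.+1%:R * cintegral `[0, x] (fun s =>
       (f s ^+ 2)^-1 * cintegral `[0, s] (fun t => f t * formal_power f k t)).
  rewrite -cintegralZ; last first.
    by apply/ccont_intg/(ccont_subitv (lexx 0) xb)/ccontM/cprim/ccontM.
  by apply: eq_cintegral => s _; ring.
rewrite /sppsV [RHS]mulrCA -(mulrA k.+2%:R) -E {E}.
rewrite {1}/formal_power [odd _]/= negbK.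
case: ifP => ok.
  rewrite /Xpow -/(Xpow f k); congr (_ * (_ * _)).
  apply: eq_cintegral => s _.
  rewrite (@exprz_sign_odd k.+2) /= ?negbK//; congr (_ * _ * _).
  apply: eq_cintegral => t _; rewrite (@exprz_sign_even k.+1) /= ?ok//.
  by rewrite /formal_power ok; ring.
rewrite /Xtilde -/(Xtilde f k); congr (_ * (_ * _)).
apply: eq_cintegral => s _.
rewrite (@exprz_sign_odd k.+1) /= ?ok//; congr (_ * _ * _).
apply: eq_cintegral => t _; rewrite (@exprz_sign_even k) /= ?ok//.
by rewrite /formal_power ok; ring.
Qed.

(** The recursion has step two, so two consecutive degrees are carried along. *)
Lemma formal_power_ccont k : ccont 0 b (formal_power f k).
Proof.
have [] : ccont 0 b (formal_power f k) /\ ccont 0 b (formal_power f k.+1); last by [].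
elim: k => [|k [IH1 IH2]]; split => //.
- by apply: ccont_eq cf => t _; rewrite formal_power0.
- apply: (@ccont_eq _ _ (fun x => f x * cintegral `[0, x] (fun s => (f s ^+ 2)^-1))).
    by move=> t _; rewrite formal_power1.
  by apply: ccontM => //; exact: cprim.
- apply: (@ccont_eq _ _ (fun x => (k.+2%:R * k.+1%:R) * sppsV (formal_power f k) x)).
    by move=> t tb; rewrite formal_powerSS.
  exact/ccontZ/sppsV_ccont.
Qed.

End Spps.
End PowerSeries.

(** * Expansion in formal powers for small spectral parameter *)

Section Asymptotics.
Variable R : realType.
Implicit Types (a b x r : R) (z w : R[i]).

Definition taylor_coef r k : R[i] := (r ^+ k / k`!%:R)%:C.

Definition taylor_rem (y : R -> R[i]) (phi : nat -> R -> R[i]) r m x : R[i] :=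
  y x - \sum_(k < m) taylor_coef r k * phi k x.

Lemma taylor_remS y phi r m x :
  taylor_rem y phi r m.+1 x = taylor_rem y phi r m x + (- taylor_coef r m) * phi m x.
Proof. by rewrite /taylor_rem big_ord_recr /= opprD addrA mulNr. Qed.

Lemma taylor_coefSS r k : taylor_coef r k.+2 * (k.+2%:R * k.+1%:R) =
  (r ^+ 2)%:C * taylor_coef r k.
Proof.
rewrite /taylor_coef -(rmorph_nat (real_complex R) k.+2)
  -(rmorph_nat (real_complex R) k.+1) -!(rmorphM (real_complex R)); congr (_%:C).
have a0 : k.+2%:R != 0 :> R by rewrite pnatr_eq0.
have c0 : k.+1%:R != 0 :> R by rewrite pnatr_eq0.
have d0 : k`!%:R != 0 :> R by rewrite pnatr_eq0 -lt0n fact_gt0.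
rewrite !factS !natrM !exprS expr0 mulr1; move: a0 c0 d0.
move: (k.+2%:R : R) (k.+1%:R : R) (k`!%:R : R) => a c d a0 c0 d0.
by field; rewrite a0 c0 d0.
Qed.

Section Family.
Variables (b : R) (f : R -> R[i]) (y : R -> R -> R[i]).
Hypotheses (b0 : 0 <= b) (cf : ccont 0 b f) (f0 : forall t, t \in `[0, b] -> f t != 0).
Hypothesis cy : forall r, ccont 0 b (y r).
Hypothesis yE : forall r x, x \in `[0, b] -> y r x = f x * (1 + cintegral `[0, x]
  (fun s => (f s ^+ 2)^-1 * (r%:C + (r ^+ 2)%:C * cintegral `[0, s] (fun t => f t * y r t)))).

Let phi := formal_power f.
Let cphi k : ccont 0 b (phi k) := formal_power_ccont b0 cf f0 k.

Lemma solution_volterra r x : x \in `[0, b] ->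
  y r x = phi 0 x + r%:C * phi 1 x + (r ^+ 2)%:C * sppsV f (y r) x.
Proof.
move=> xb; rewrite yE// /phi formal_power0 formal_power1 /sppsV.
have [x0 xb'] : 0 <= x /\ x <= b by move: xb; rewrite in_itv /= => /andP[].
have cfm2 := ccont_sqrV f0 cf.
pose I s := (f s ^+ 2)^-1 * cintegral `[0, s] (fun t => f t * y r t).
have cI : ccont 0 b I.
  by apply: ccontM => //; exact: cC1_ccont (cC1_primitive b0 (ccontM cf (cy r))).
have -> : cintegral `[0, x] (fun s => (f s ^+ 2)^-1 *
     (r%:C + (r ^+ 2)%:C * cintegral `[0, s] (fun t => f t * y r t)))
   = cintegral `[0, x] (fun s => r%:C * (f s ^+ 2)^-1 + (r ^+ 2)%:C * I s).
  by apply: eq_cintegral => s _; rewrite /I mulrDr [_ * r%:C]mulrC [_ * ((r ^+ 2)%:C * _)]mulrCA.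
have i1 := ccont_intg (ccont_subitv (lexx 0) xb' cfm2).
have i2 := ccont_intg (ccont_subitv (lexx 0) xb' cI).
rewrite cintegralD; [|by apply: cintgM => //; exact: ccont_cst..].
rewrite !cintegralZ// !mulrDr mulr1 addrA.
by rewrite [f x * (r%:C * _)]mulrCA [f x * ((r ^+ 2)%:C * _)]mulrCA.
Qed.

Lemma taylor_rem_ccont r m : ccont 0 b (taylor_rem (y r) phi r m).
Proof.
elim: m => [|m IH].
  by apply: ccont_eq (cy r) => t _; rewrite /taylor_rem big_ord0 subr0.
apply: (@ccont_eq _ _ _ (fun x => taylor_rem (y r) phi r m x + (- taylor_coef r m) * phi m x)).
  by move=> t _; rewrite taylor_remS.
by apply: ccontD => //; exact: ccontZ.
Qed.

(** Induction in single steps: removing the next term on both sides is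
    compatible with the formula, by linearity of [sppsV] and the recursion of
    the formal powers. *)
Lemma taylor_remSS r m x : x \in `[0, b] -> taylor_rem (y r) phi r m.+2 x =
  (r ^+ 2)%:C * sppsV f (taylor_rem (y r) phi r m) x.
Proof.
move=> xb; elim: m => [|m IH].
  have -> : taylor_rem (y r) phi r 0 = y r.
    by apply/funext => t; rewrite /taylor_rem big_ord0 subr0.
  rewrite !taylor_remS /taylor_rem big_ord0 subr0 solution_volterra//.
  by rewrite /taylor_coef fact0 expr0 expr1 divr1 factS fact0 muln1 divr1 rmorph1; ring.
rewrite taylor_remS IH.
have -> : taylor_rem (y r) phi r m.+1 =
    fun t => taylor_rem (y r) phi r m t + (- taylor_coef r m) * phi m t.
  by apply/funext => t; rewrite taylor_remS.
have cr := taylor_rem_ccont r m.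
rewrite (sppsV_linear b0 cf f0)// mulrDr; congr (_ + _).
rewrite {1}/phi (formal_powerSS b0 cf f0)// [LHS]mulrA [- _ * (_ * _)]mulNr taylor_coefSS.
by rewrite !mulNr mulrN mulrA.
Qed.

(** At a point where [norm1 (y r)] is maximal the integral equation bounds this
    maximum [M] by [A + r^2 B M], and for small [r] the last term is absorbed. *)
Lemma solution_bounded : exists d, [/\ 0 < d, d <= 1 & exists C : R,
  forall r, `|r| <= d -> forall x, x \in `[0, b] -> norm1 (y r x) <= C].
Proof.
have [B B0 HB] := sppsV_bound b0 cf f0.
have [c0 _ H0] := ccont_max b0 (cphi 0); have [c1 _ H1] := ccont_max b0 (cphi 1).
pose A := norm1 (phi 0 c0) + norm1 (phi 1 c1).
have dpos : 0 < 1 + 2 * B by rewrite ltr_pwDl// mulr_ge0.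
(* This bound on r gives r^2 B <= |r| B <= 1 / 2. *)
exists (1 + 2 * B)^-1; split; first by rewrite invr_gt0.
  by rewrite invf_le1// lerDl mulr_ge0.
exists (2 * A) => r rd x xb.
have [c cb Hc] := ccont_max b0 (cy r).
apply: le_trans (Hc x xb) _; set M := norm1 (y r c).
have r1 : `|r| <= 1 by apply: le_trans rd _; rewrite invf_le1// lerDl mulr_ge0.
have M1 : M <= A + `|r| * (B * M).
  rewrite {1}/M solution_volterra//.
  apply: le_trans (norm1D _ _) _; apply: lerD.
    apply: le_trans (norm1D _ _) _; apply: lerD; first exact: H0.
    apply: le_trans (norm1M _ _) _; rewrite norm1_real -[leRHS]mul1r.
    by apply: ler_pM => //; [exact: norm1_ge0|exact: H1].
  apply: le_trans (norm1M _ _) _; rewrite norm1_real normrX.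
  apply: ler_pM; rewrite ?norm1_ge0//; last exact: HB.
  by rewrite expr2 ler_piMl.
have M0 : 0 <= M by exact: norm1_ge0.
have rB : `|r| * B <= 1 / 2.
  have : `|r| * B <= (1 + 2 * B)^-1 * B by rewrite ler_wpM2r.
  move=> /le_trans; apply; rewrite ler_pdivrMl//; nra.
have : `|r| * (B * M) <= 1 / 2 * M by rewrite mulrA ler_wpM2r.
move: M1; lra.
Qed.

Lemma spps_asymptotic : exists d, [/\ 0 < d, d <= 1 & forall n, exists C : R,
  forall r, `|r| <= d -> forall x, x \in `[0, b] ->
    norm1 (taylor_rem (y r) phi r n.*2 x) <= C * `|r| ^+ n.*2].
Proof.
have [d [d0 d1 [C HC]]] := solution_bounded.
have [B B0 HB] := sppsV_bound b0 cf f0.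
exists d; split => //; elim=> [|n [D HD]].
  exists C => r rd x xb; rewrite /taylor_rem big_ord0 subr0 expr0 mulr1; exact: HC.
exists (B * D) => r rd x xb; rewrite doubleS taylor_remSS//.
apply: le_trans (norm1M _ _) _; rewrite norm1_real.
have -> : B * D * `|r| ^+ n.*2.+2 = `|r| ^+ 2 * (B * (D * `|r| ^+ n.*2)).
  by rewrite exprS exprS; ring.
rewrite normrX ler_wpM2l ?exprn_ge0//; apply: HB => //.
  exact: taylor_rem_ccont.
by move=> t tb; exact: HD.
Qed.

End Family.

Lemma norm_le_small_eq0 (a D d : R) : 0 < d -> 0 <= D ->
  (forall r, 0 < r <= d -> `|a| <= r * D) -> a = 0.
Proof.
move=> d0 D0 H; apply/normr0_eq0/eqP; rewrite eq_le normr_ge0 andbT.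
apply/ler_addgt0Pl => e e0; rewrite addr0.
pose r := Num.min d (e / (D + 1)).
have D1 : 0 < D + 1 by rewrite ltr_wpDl.
have r0 : 0 < r by rewrite lt_min d0 divr_gt0.
have rd : r <= d by rewrite ge_min lexx.
have re : r <= e / (D + 1) by rewrite ge_min lexx orbT.
apply: le_trans (H r _) _; first by rewrite r0.
apply: le_trans (ler_wpM2r D0 re) _.
rewrite mulrAC ler_pdivrMr// ler_pM2l// lerDl//.
Qed.

(** The lowest coefficient vanishes by letting [r] tend to zero; the others
    follow after division by [r]. *)
Lemma small_sum_coef_eq0 m (a : nat -> R) (C d : R) : 0 < d -> 0 <= C ->
  (forall r, 0 < r <= d -> `|\sum_(k < m) a k * r ^+ k| <= C * r ^+ m) ->
  forall k, (k < m)%N -> a k = 0.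
Proof.
elim: m a => [//|m IH] a d0 C0 H.
pose S r := \sum_(k < m) a k.+1 * r ^+ k.
have SE r : \sum_(k < m.+1) a k * r ^+ k = a 0%N + r * S r.
  rewrite big_ord_recl expr0 mulr1 mulr_sumr; congr (_ + _).
  by apply: eq_bigr => i _; rewrite lift0 exprS mulrCA.
have a0 : a 0%N = 0.
  apply: (@norm_le_small_eq0 _ (C + \sum_(k < m) `|a k.+1|) (Num.min d 1)).
  - by rewrite lt_min d0 ltr01.
  - by rewrite addr_ge0// sumr_ge0.
  move=> r; rewrite le_min => /and3P[r0 rd r1].
  have -> : a 0%N = (\sum_(k < m.+1) a k * r ^+ k) - r * S r by rewrite SE addrK.
  apply: le_trans (ler_normB _ _) _; rewrite mulrDr; apply: lerD.
    apply: le_trans (H r _) _; first by rewrite r0.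
    rewrite mulrC ler_wpM2r// exprS ler_piMr ?(ltW r0)//.
    by apply: exprn_ile1 => //; exact: ltW.
  rewrite normrM gtr0_norm// ler_wpM2l ?(ltW r0)//.
  apply: le_trans (ler_norm_sum _ _ _) _; apply: ler_sum => i _.
  rewrite normrM ler_piMr// normrX gtr0_norm//.
  by apply: exprn_ile1 => //; exact: ltW.
move=> [_ //|k] km; apply: (IH (fun k => a k.+1)) => // r /andP[r0 rd].
have := H r; rewrite r0 rd SE a0 add0r normrM gtr0_norm// exprS mulrCA ler_pM2l//.
by apply.
Qed.

End Asymptotics.

(** * Folding an integral over a symmetric interval *)

Section Reflection.
Variable R : realType.
Notation mu := (@lebesgue_measure R).
Notation intg a b u := (mu.-integrable `[a, b] (EFin \o u)).
Implicit Types (a b x r : R) (z w : R[i]).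

Lemma ge0_integral_reflect (D : set R) (F : R -> \bar R) : measurable D ->
  measurable_fun setT F -> (forall t, 0 <= F t)%E ->
  (\int[mu]_(t in (-%R : R -> R) @^-1` D) F (- t)%R = \int[mu]_(t in D) F t)%E.
Proof.
move=> mD mF F0; rewrite [LHS](_ : _ =
   (\int[mu]_(t in (-%R : _ -> measurableTypeR R) @^-1` D) F (- t)%R)%E)//.
rewrite -ge0_integral_pushforward//=; last exact: measurable_funTS.
by apply: eq_measure_integral => //= A mA AS; exact: lebesgue_measureN.
Qed.

Lemma integral_reflect (D : set R) (F : R -> \bar R) : measurable D ->
  measurable_fun setT F -> mu.-integrable ((-%R : R -> R) @^-1` D) (fun t => F (- t)) ->
  (\int[mu]_(t in (-%R : R -> R) @^-1` D) F (- t)%R = \int[mu]_(t in D) F t)%E.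
Proof.
move=> mD mF iF; rewrite [LHS](_ : _ =
   (\int[mu]_(t in (-%R : _ -> measurableTypeR R) @^-1` D) (F \o (-%R : _ -> measurableTypeR R)) t)%E)//.
rewrite -integral_pushforward//=.
by apply: eq_measure_integral => //= A mA AS; exact: lebesgue_measureN.
Qed.

(** Restricting [g] to the interval first makes it measurable on the whole
    line, as the change of variables requires. *)
Lemma integrable_reflect a b (g : R -> R) : intg a b g ->
  intg (- b) (- a) (fun t => g (- t)) /\
  \int[mu]_(t in `[- b, - a]) g (- t) = \int[mu]_(t in `[a, b]) g t.
Proof.
move=> ig; pose G := g \_ `[a, b].
have iG : mu.-integrable setT (EFin \o G).
  by rewrite -restrict_EFin; apply/integrable_restrict => //; rewrite setTI.
have mG : measurable_fun setT (EFin \o G) by exact: measurable_int iG.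
have pre : (-%R : R -> R) @^-1` `[a, b] = `[- b, - a]%classic.
  apply/seteqP; split => t /=; rewrite !in_itv /= => /andP[t1 t2].
    by rewrite lerNl t2 lerNr t1.
  by rewrite lerNr t2 lerNl t1.
have gG t : t \in `[- b, - a] -> g (- t) = G (- t).
  move=> tab; rewrite /G patchE mem_setE ifT//.
  by move: tab; rewrite !in_itv /= => /andP[t1 t2]; rewrite lerNr t2 lerNl t1.
have iGN : mu.-integrable `[- b, - a] (fun t => (EFin \o G) (- t)).
  apply/integrableP; split.
    apply: (@measurable_funS _ _ _ _ setT) => //.
    by apply: measurableT_comp mG _; exact: measurable_funN.
  rewrite -pre (ge0_integral_reflect (F := fun t => `|(EFin \o G) t|%E))//; last first.
    exact: measurableT_comp.
  have /integrableP[_] : mu.-integrable `[a, b] (EFin \o G).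
    exact: integrableS iG.
  by [].
split.
  apply: eq_integrable iGN => //.
  by move=> t; rewrite mem_setE => tab /=; rewrite gG.
rewrite -pre in iGN.
have := integral_reflect (measurable_itv `[a, b]) mG iGN; rewrite pre => E.
transitivity (\int[mu]_(t in `[- b, - a]) G (- t)).
  by apply: eq_Rintegral => t; rewrite mem_setE; exact: gG.
transitivity (\int[mu]_(t in `[a, b]) G t); last first.
  by apply: eq_Rintegral => t tab; rewrite /G patchE tab.
by rewrite /Rintegral; congr fine; exact: E.
Qed.

Lemma Rintegral_fold x (g : R -> R) : 0 <= x -> intg (- x) x g ->
  \int[mu]_(t in `[- x, x]) g t = \int[mu]_(t in `[0, x]) (g t + g (- t)).
Proof.
move=> x0 ig; have Nx0 : - x <= 0 by rewrite oppr_le0.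
have i1 : intg 0 x g by exact: integrable_itvS ig.
have i2 : intg (- x) 0 g by exact: integrable_itvS ig.
have [] := integrable_reflect i2; rewrite opprK oppr0 => i3 e3.
rewrite RintegralD// e3 addrC; apply/eqP; rewrite addrC -subr_eq; apply/eqP.
rewrite Rintegral_itvB// Rintegral_itv_obnd_cbnd//.
by apply: integrableS i1 => //; apply: subset_itv; rewrite bnd_simp.
Qed.

Lemma cintegral_fold x (g : R -> R[i]) : 0 <= x -> cintg (- x) x g ->
  cintegral `[- x, x] g = cintegral `[0, x] (fun t => g t + g (- t)).
Proof.
move=> x0 [i1 i2]; apply: complex_eq => /=.
- by rewrite Rintegral_fold//; apply: eq_Rintegral => t _; rewrite cReD.
- by rewrite Rintegral_fold//; apply: eq_Rintegral => t _; rewrite cImD.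
Qed.

End Reflection.

(** * Expansion of the transmutation formula *)

Section Kernel.
Variable R : realType.
Notation mu := (@lebesgue_measure R).
Notation intg a b u := (mu.-integrable `[a, b] (EFin \o u)).
Implicit Types (a b x r : R) (z w : R[i]).

Definition expR_rem m s : R := expR s - \sum_(k < m) s ^+ k / k`!%:R.

Lemma expR_remS m s : expR_rem m.+1 s = expR_rem m s - s ^+ m / m`!%:R.
Proof. by rewrite /expR_rem big_ord_recr /= opprD addrA. Qed.

Lemma is_derive_expR_rem m (s : R) : is_derive s 1 (expR_rem m.+1) (expR_rem m s).
Proof.
elim: m => [|m IH].
  rewrite (_ : expR_rem 1 = expR - cst 1).
    by apply: is_derive_eq; rewrite /expR_rem big_ord0.
  by apply/funext => t; rewrite /expR_rem big_ord1 expr0 fact0 divr1.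
have dX : is_derive s 1 (m.+1`!%:R^-1 \*: ((id : R -> R) ^+ m.+1)) (s ^+ m / m`!%:R).
  apply: is_derive_eq; rewrite /GRing.scale /= mulr1 factS natrM.
  have a0 : m.+1%:R != 0 :> R by rewrite pnatr_eq0.
  have c0 : m`!%:R != 0 :> R by rewrite pnatr_eq0 -lt0n fact_gt0.
  move: a0 c0; move: (m.+1%:R : R) (m`!%:R : R) => p d p0 d0.
  by field; rewrite p0 d0.
have := is_deriveB IH dX; rewrite -expR_remS; congr is_derive.
by apply/funext => t; rewrite [RHS]expR_remS /= [_ / _]mulrC exprfctE.
Qed.

Lemma continuous_expR_rem m : continuous (expR_rem m).
Proof.
case: m => [|m] t.
  rewrite (_ : expR_rem 0 = expR); first exact: continuous_expR.
  by apply/funext => s; rewrite /expR_rem big_ord0 subr0.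
by apply: differentiable_continuous; apply/derivable1_diffP; case: (is_derive_expR_rem m t).
Qed.

(** The derivative of a remainder is the previous remainder, so the mean value
    theorem yields one more factor [|s|]. *)
Lemma expR_rem_bound m s : `|expR_rem m s| <= `|s| ^+ m * expR `|s|.
Proof.
elim: m s => [|m IH] s.
  by rewrite /expR_rem big_ord0 subr0 expr0 mul1r gtr0_norm ?expR_gt0// ler_expR ler_norm.
have d (t : R) : is_derive t 1 (expR_rem m.+1) (expR_rem m t) := is_derive_expR_rem m t.
have E0 : expR_rem m.+1 0 = 0.
  rewrite /expR_rem big_ord_recl expR0 expr0 fact0 divr1 big1 ?addr0 ?subrr// => i _.
  by rewrite lift0 expr0n mul0r.
have step c : `|c| <= `|s| -> `|expR_rem m c * s| <= `|s| ^+ m.+1 * expR `|s|.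
  move=> cs; rewrite normrM exprSr mulrAC ler_wpM2r//.
  apply: le_trans (IH c) _; apply: ler_pM; rewrite ?exprn_ge0 ?expR_ge0//.
    by rewrite lerXn2r ?nnegrE.
  by rewrite ler_expR.
have cw a b : {within `[a, b], continuous (expR_rem m.+1)}.
  by apply: continuous_subspaceT; exact: continuous_expR_rem.
have [s0|s0] := leP 0 s.
  have [c] := MVT_segment s0 (fun t _ => d t) (cw _ _).
  rewrite in_itv /= E0 !subr0 => /andP[c0 cs] ->; apply: step.
  by rewrite !ger0_norm.
have [c] := MVT_segment (ltW s0) (fun t _ => d t) (cw _ _).
rewrite in_itv /= E0 !sub0r => /andP[sc c0] /eqP; rewrite mulrN eqr_opp => /eqP ->.
by apply: step; rewrite !ler0_norm ?lerN2// ltW.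
Qed.

Lemma ccont_real a b (g : R -> R) : {within `[a, b], continuous g} ->
  ccont a b (fun t => (g t)%:C).
Proof. by move=> cg; split => //= t; exact: cvg_cst. Qed.

Lemma ccont_monomial a b k : ccont a b (fun t => t%:C ^+ k).
Proof.
rewrite (_ : (fun _ => _) = (fun t => (t ^+ k)%:C)).
  by apply: ccont_real; apply: continuous_subspaceT; exact: exprn_continuous.
by apply/funext => t; rewrite rmorphXn.
Qed.

Lemma ccont_expR_rem a b r m : ccont a b (fun t => (expR_rem m (r * t))%:C).
Proof.
apply: ccont_real; apply: continuous_subspaceT => t.
apply: (@continuous_comp _ _ _ (fun t => r * t) (expR_rem m)).
  by apply: cvgM; [exact: cvg_cst|exact: cvg_id].
exact: continuous_expR_rem.
Qed.

Lemma cintegral_mul_bound a b (u : R -> R[i]) : cintg a b u -> exists2 L, 0 <= L &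
  forall (g : R -> R) M, {within `[a, b], continuous g} ->
    (forall t, t \in `[a, b] -> `|g t| <= M) ->
    norm1 (cintegral `[a, b] (fun t => u t * (g t)%:C)) <= M * L.
Proof.
move=> [i1 i2].
exists (\int[mu]_(t in `[a, b]) `|Re (u t)| + \int[mu]_(t in `[a, b]) `|Im (u t)|).
  by apply: addr_ge0; apply: Rintegral_ge0 => t _; exact: normr_ge0.
move=> g M cg gM.
have key (p : R -> R) : intg a b p ->
    `|\int[mu]_(t in `[a, b]) (p t * g t)| <= M * \int[mu]_(t in `[a, b]) `|p t|.
  move=> ip.
  have ipg : intg a b (fun t => p t * g t).
    exact: integrableMr_continuous.
  apply: le_trans (le_normr_Rintegral _ ipg) _ => //.
  have ipn : intg a b (fun t => `|p t|) by exact: integrable_norm ip.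
  rewrite -RintegralZl//; apply: le_Rintegral => //.
  - exact: integrable_norm ipg.
  - exact: integrableZ_itv.
  - by move=> t tab; rewrite normrM mulrC ler_wpM2r// gM.
rewrite mulrDr /norm1; apply: lerD; rewrite /cintegral /=.
- rewrite (_ : \int[mu]_(t in `[a, b]) Re (u t * (g t)%:C) = \int[mu]_(t in `[a, b]) (Re (u t) * g t)).
    exact: key.
  by apply: eq_Rintegral => t _; rewrite cReM /= mulr0 subr0.
- rewrite (_ : \int[mu]_(t in `[a, b]) Im (u t * (g t)%:C) = \int[mu]_(t in `[a, b]) (Im (u t) * g t)).
    exact: key.
  by apply: eq_Rintegral => t _; rewrite cImM /= mulr0 add0r.
Qed.

Lemma kernel_taylor_rem (K : R -> R -> R[i]) x r m : cintg (- x) x (K x) ->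
  taylor_rem (opT K (fun t => (expR (r * t))%:C)) (fun k => opT K (fun t => t%:C ^+ k)) r m x =
  opT K (fun t => (expR_rem m (r * t))%:C) x.
Proof.
move=> iK; elim: m => [|m IH].
  have E0 : expR_rem 0 = expR by apply/funext => s; rewrite /expR_rem big_ord0 subr0.
  by rewrite /taylor_rem big_ord0 subr0 E0.
have E t : (expR_rem m.+1 (r * t))%:C = (expR_rem m (r * t))%:C + (- taylor_coef r m) * t%:C ^+ m :> R[i].
  rewrite expR_remS /taylor_coef rmorphB mulNr -rmorphXn -rmorphM exprMn; congr (_ - _%:C).
  by rewrite mulrAC.
have i0 k : cintg (- x) x (fun t => K x t * t%:C ^+ k).
  by apply: cintgMr => //; exact: ccont_monomial.
have i1 k : cintg (- x) x (fun t => K x t * (expR_rem k (r * t))%:C).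
  by apply: cintgMr => //; exact: ccont_expR_rem.
rewrite taylor_remS IH /opT.
have -> : cintegral `[- x, x] (fun t => K x t * (expR_rem m.+1 (r * t))%:C) =
  cintegral `[- x, x] (fun t => K x t * (expR_rem m (r * t))%:C +
    (- taylor_coef r m) * (K x t * t%:C ^+ m)).
  by apply: eq_cintegral => t _; rewrite E mulrDr [K x t * (_ * _)]mulrCA.
rewrite cintegralD//; last by apply: cintgM => //; exact: ccont_cst.
by rewrite cintegralZ// E mulrDr addrACA.
Qed.

Lemma kernel_taylor_bound (K : R -> R -> R[i]) x m : 0 <= x -> cintg (- x) x (K x) ->
  exists C, forall r, `|r| <= 1 ->
   norm1 (taylor_rem (opT K (fun t => (expR (r * t))%:C))
     (fun k => opT K (fun t => t%:C ^+ k)) r m x) <= C * `|r| ^+ m.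
Proof.
move=> x0 iK; have [L L0 HL] := cintegral_mul_bound iK.
exists (x ^+ m * expR x * (1 + L)) => r r1.
rewrite kernel_taylor_rem// /opT.
have gM t : t \in `[- x, x] -> `|expR_rem m (r * t)| <= `|r| ^+ m * (x ^+ m * expR x).
  rewrite in_itv /= -ler_norml => tx; apply: le_trans (expR_rem_bound _ _) _.
  rewrite normrM exprMn -mulrA ler_wpM2l ?exprn_ge0//.
  apply: ler_pM; rewrite ?exprn_ge0 ?expR_ge0//; first by rewrite lerXn2r ?nnegrE.
  by rewrite ler_expR; apply: le_trans tx; rewrite ler_piMl.
apply: le_trans (norm1D _ _) _.
have -> : x ^+ m * expR x * (1 + L) * `|r| ^+ m =
  `|r| ^+ m * (x ^+ m * expR x) + `|r| ^+ m * (x ^+ m * expR x) * L by ring.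
apply: lerD; first by rewrite norm1_real; apply: gM; rewrite in_itv /=; rewrite ge0_cp ?lexx.
apply: HL => //; apply: continuous_subspaceT => t.
apply: (@continuous_comp _ _ _ (fun t => r * t) (expR_rem m)).
  by apply: cvgM; [exact: cvg_cst|exact: cvg_id].
exact: continuous_expR_rem.
Qed.

Lemma asymptotic_expansion_unique (y : R -> R -> R[i]) (phi psi : nat -> R -> R[i]) x d : 0 < d ->
  (forall n, exists C : R, forall r, `|r| <= d ->
     norm1 (taylor_rem (y r) phi r n.*2 x) <= C * `|r| ^+ n.*2) ->
  (forall n, exists C : R, forall r, `|r| <= d ->
     norm1 (taylor_rem (y r) psi r n.*2 x) <= C * `|r| ^+ n.*2) ->
  forall k, phi k x = psi k x.
Proof.
move=> d0 H1 H2 k; have [C1 HC1] := H1 k.+1; have [C2 HC2] := H2 k.+1.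
pose m := k.+1.*2; pose D j := psi j x - phi j x.
have bound r : `|r| <= d -> norm1 (\sum_(j < m) taylor_coef r j * D j) <= (C1 + C2) * `|r| ^+ m.
  move=> rd; rewrite (_ : \sum_(j < m) _ = taylor_rem (y r) phi r m x - taylor_rem (y r) psi r m x).
    apply: le_trans (norm1D _ _) _; rewrite norm1N mulrDl.
    by apply: lerD; [exact: HC1|exact: HC2].
  rewrite /taylor_rem opprB addrC subrKA -sumrB.
  by apply: eq_bigr => j _; rewrite /D mulrBr.
have C0 : 0 <= C1 + C2.
  have := bound d; rewrite ger0_norm ?(ltW d0)// lexx => /(_ isT) /(le_trans (norm1_ge0 _)).
  by rewrite pmulr_lge0// exprn_gt0.
have km : (k < m)%N by rewrite /m -addnn ltn_addr.
have key (p : R[i] -> R) : {morph p : z w / z + w} -> p 0 = 0 ->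
    (forall s z, p (s%:C * z) = s * p z) -> (forall z, `|p z| <= norm1 z) -> p (D k) = 0.
  move=> pD p0 pZ pN.
  have : p (D k) / k`!%:R = 0.
    apply: (@small_sum_coef_eq0 R m (fun j => p (D j) / j`!%:R) (C1 + C2) d) => // r /andP[r0 rd].
    have := bound r; rewrite gtr0_norm// => /(_ rd); apply: le_trans.
    apply: le_trans (pN _); rewrite (big_morph p pD p0).
    rewrite le_eqVlt; apply/orP; left; apply/eqP; congr `|_|.
    by apply: eq_bigr => j _; rewrite pZ [LHS]mulrC [p _ / _]mulrC mulrA.
  move/eqP; rewrite mulf_eq0 invr_eq0 pnatr_eq0 -leqn0 leqNgt fact_gt0 orbF.
  by move/eqP.
suff : D k = 0 by rewrite /D => /eqP; rewrite subr_eq0 => /eqP.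
apply: complex_eq.
- apply: (key (@complex.Re R)) => //.
  + exact: cReD.
  + by move=> s z; rewrite cReM /= mul0r subr0.
  + by move=> z; rewrite lerDl.
- apply: (key (@complex.Im R)) => //.
  + exact: cImD.
  + by move=> s z; rewrite cImM /= mul0r addr0.
  + by move=> z; rewrite lerDr.
Qed.

End Kernel.

(** * Images of the monomials *)

Section FormalPowers.
Variable R : realType.
Implicit Types (a b x r : R) (z w : R[i]).

Lemma cexp_real (s : R) : cexp s%:C = (expR s)%:C.
Proof. by rewrite /cexp /= cos0 sin0 mulr1. Qed.

Lemma opT_fold (K : R -> R -> R[i]) x (u : R -> R[i]) :
  0 <= x -> cintg (- x) x (K x) -> ccont (- x) x u ->
  ((forall t, u (- t) = u t) -> opTC K u x = opT K u x) /\
  ((forall t, u (- t) = - u t) -> opTS K u x = opT K u x).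
Proof.
move=> x0 iK cu.
have iKu : cintg (- x) x (fun t => K x t * u t) by exact: cintgMr.
split=> uN; congr (_ + _); rewrite (cintegral_fold x0 iKu);
  apply: eq_cintegral => t _; rewrite uN.
- by rewrite /kernelG mulrDl.
- by rewrite /kernelS mulrBl mulrN.
Qed.

(** The parameter [rho = - i r] turns [exp (i rho t)] into the real exponential
    [exp (r t)] and [rho^2] into [- r^2]. *)
Lemma opT_formal_power b (hb : 0 < b)
    (q : R -> R[i]) (N : nat) (xs : nat -> R) (alpha : nat -> R[i])
    (hI : interactions b N xs alpha)
    (f : R -> R[i]) (hf : is_solution q b N xs alpha 0 f)
    (hf_neq0 : forall x, 0 <= x <= b -> f x != 0) (hf0 : f 0 = 1)
    (h : R[i]) (hh : is_right_derivative f 0 h)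
    (e : R[i] -> R -> R[i]) (he : is_e q b N xs alpha h e)
    (K : R -> R -> R[i]) (hK : is_transmutation_kernel b e K) k x :
  0 <= x <= b -> opT K (fun t => t%:C ^+ k) x = formal_power f k x.
Proof.
case: hK => _ KL2 eK; move=> /andP[]; rewrite le_eqVlt => /predU1P[<- _|x0 xb].
  rewrite /opT oppr0 cintegral_point addr0.
  case: k => [|k]; first by rewrite formal_power0 hf0 expr0.
  rewrite /formal_power /= !cintegral_point !mulr0 exprS.
  by rewrite if_same mulr0 mul0r.
pose rho r : R[i] := - ('i * r%:C).
pose y r := e (rho r).
have irho r : 'i * rho r = r%:C :> R[i].
  by rewrite /rho mulrN mulrA -expr2 sqrCi mulN1r opprK.
have rho2 r : rho r ^+ 2 = - (r ^+ 2)%:C :> R[i].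
  by rewrite /rho sqrrN exprMn sqrCi mulN1r rmorphXn.
have b0 := ltW hb.
have cf : ccont 0 b f by case: hf => -[/abs_continuous_ccont].
have f0 t : t \in `[0, b] -> f t != 0 by rewrite in_itv /=; exact: hf_neq0.
have cy r : ccont 0 b (y r) by case: (he (rho r)) => -[[/abs_continuous_ccont]].
have yE r t : t \in `[0, b] -> y r t = f t * (1 + cintegral `[0, t]
    (fun s => (f s ^+ 2)^-1 * (r%:C + (r ^+ 2)%:C * cintegral `[0, s] (fun t => f t * y r t)))).
  rewrite in_itv /= => tb; have [se e01 ek] := he (rho r).
  rewrite /y (solution_quotient hI hf se hf_neq0 hf0 e01 hh ek tb).
  congr (_ * (1 + _)); apply: eq_cintegral => s _.
  by rewrite irho rho2 addrK mulNr opprK.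
have [d [d0 d1 H1]] := spps_asymptotic b0 cf f0 cy yE.
apply/esym; move: k.
apply: (@asymptotic_expansion_unique R y (formal_power f)
  (fun k => opT K (fun t => t%:C ^+ k)) x d d0) => n.
  have [C HC] := H1 n; exists C => r rd; apply: HC => //.
  by rewrite in_itv /= ltW.
have iK : cintg (- x) x (K x) by apply: in_L2_cintg; apply: KL2; rewrite x0.
have [C HC] := kernel_taylor_bound n.*2 (ltW x0) iK.
exists C => r rd; have := HC r (le_trans rd d1).
rewrite /taylor_rem (_ : y r x = opT K (fun t => (expR (r * t))%:C) x)//.
rewrite /y eK ?x0// irho -rmorphM cexp_real /opT; congr (_ + _).
by apply: eq_cintegral => t _; rewrite -rmorphM cexp_real.
Qed.

End FormalPowers.

Theorem theorem26 (R : realType) (b : R) (hb : 0 < b)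
    (q : R -> R[i]) (hq : in_L2 0 b q)
    (N : nat) (hN : (1 <= N)%N) (xs : nat -> R) (alpha : nat -> R[i])
    (hI : interactions b N xs alpha)
    (f : R -> R[i]) (hf : is_solution q b N xs alpha 0 f)
    (hf_neq0 : forall x, 0 <= x <= b -> f x != 0) (hf0 : f 0 = 1)
    (h : R[i]) (hh : is_right_derivative f 0 h)
    (e : R[i] -> R -> R[i]) (he : is_e q b N xs alpha h e)
    (K : R -> R -> R[i]) (hK : is_transmutation_kernel b e K) :
  [/\ forall (k : nat) (x : R), 0 <= x <= b ->
        opT K (fun t => t%:C ^+ k) x = formal_power f k x,
      forall (k : nat) (x : R), 0 <= x <= b ->
        opTC K (fun t => t%:C ^+ (2 * k)) x = formal_power f (2 * k) x &
      forall (k : nat) (x : R), 0 <= x <= b ->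
        opTS K (fun t => t%:C ^+ (2 * k + 1)) x =
        formal_power f (2 * k + 1) x].
Proof.
have main := opT_formal_power hb hI hf hf_neq0 hf0 hh he hK.
have fold k x : 0 <= x <= b ->
    (~~ odd k -> opTC K (fun t => t%:C ^+ k) x = opT K (fun t => t%:C ^+ k) x) /\
    (odd k -> opTS K (fun t => t%:C ^+ k) x = opT K (fun t => t%:C ^+ k) x).
  case: hK => _ KL2 _ /andP[]; rewrite le_eqVlt => /predU1P[<- _|x0 xb].
    by rewrite /opTC /opTS /opT oppr0 !cintegral_point.
  have iK : cintg (- x) x (K x) by apply: in_L2_cintg; apply: KL2; rewrite x0.
  have [even_fold odd_fold] := opT_fold (ltW x0) iK (ccont_monomial (- x) x k).
  split=> ok; [apply: even_fold|apply: odd_fold] => t;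
    by rewrite rmorphN exprNn -signr_odd ?ok ?(negbTE ok) ?mul1r ?mulN1r.
split=> // k x xb.
- by rewrite (fold _ _ xb).1 ?main// oddM.
- by rewrite (fold _ _ xb).2 ?main// oddD oddM.
Qed.
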